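(* For each $t\in J$, $\rho_t'$ is an Oxtoby–Ulam measure on $\hat D_t$, and the set of points of $\hat D_t$ that are regular for $\hat\mu_t$ under $\hat H_t$ has positive $\rho_t'$-measure.
   Context: Setup: $I=[-1,1]$, $J=(1,2]$, $f_t(x)=\min(t(x-1)+3,\,t(1-x)-1)$, $\mu_t$ its unique absolutely continuous invariant probability. $S$ is the circle of radius 2 with angular coordinate $y$; $D$ the disk of radius 2 with coordinates $(y,s)\in S\times[0,1]$ (from a smooth embedding of the mapping cylinder of $y\mapsto\cos y$), $(y,0)=y\in S$, $(y,1)=\cos y\in I\subset D$. $\Upsilon(y,s)=(y,2s)$ for $s\le1/2$, $(y,1)$ for $s\ge1/2$. An unwrapping is a continuous family of orientation-preserving near-homeomorphisms $\bar f_t\colon D\to D$ with $\bar f_t$ injective on $I$, $\bar f_t(I)\subset\{s\ge1/2\}$, $\Upsilon\circ\bar f_t|_I=f_t$, the second coordinate of $\bar f_t(y,s)$ equal to $s$ for $s\le1/2$; assume also $\bar f_t=\mathrm{id}$ on $S\times[0,3/4]$. $H_t=\Upsilon\circ\bar f_t$, $\hat D_t=\varprojlim(D,H_t)$ (a topological disk), natural extension $\hat H_t$, $\hat I_t=\varprojlim(I,f_t)\subset\hat D_t$, and $\hat\mu_t$ the $\hat H_t$-invariant measure with $(\pi_n)_*\hat\mu_t=\mu_t$ for all projections $\pi_n$. Let $A=S\times[0,\infty)$ and $\Psi_t\colon A\to\hat D_t\setminus\hat I_t$: for $s<1$, $\Psi_t(y,s)=\langle(y,s),(y,s/2),\dots\rangle$;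 for $s\ge1$, with $k=\lfloor s\rfloor$, $v=(s-k+1)/2$, $\Psi_t(y,s)=\langle z_0,z_1,\dots\rangle$, $z_{k-j}=H_t^{\,j}(y,v)$ ($1\le j\le k$), $z_k=(y,v)$, $z_{k+j}=(y,v/2^j)$. Let $m$ be the probability measure on $A$ with $dm=\frac1K\arctan(s)\,dy\,ds$ ($K$ a normalizing constant), and $\rho_t'$ the Borel probability measure on $\hat D_t$ given by $\rho_t'(E)=m(\Psi_t^{-1}(E\setminus\hat I_t))$ (so $\rho_t'(\hat I_t)=0$). A Borel probability measure on a manifold is Oxtoby–Ulam if it is non-atomic, positive on nonempty open sets, and gives zero measure to the manifold boundary. A point $x$ is regular for an invariant probability $\nu$ under $f$ if $\frac1n\sum_{i<n}\alpha(f^ix)\to\int\alpha\,d\nu$ for all continuous $\alpha$.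
   Formalization: The measure m is taken as dm = (1/K) dy d(arctan s) = (1/K)(1+s²)^{-1} dy ds with K = π², because the stated density (1/K) arctan(s) dy ds has infinite total mass on S×[0,∞) and cannot be normalized. *)

(* Defs.v *)
From HB Require Import structures.
From mathcomp Require Import all_boot all_order all_algebra.
From mathcomp Require Import all_classical all_reals all_analysis.
Set Implicit Arguments.
Unset Strict Implicit.
Unset Printing Implicit Defensive.
Import Order.TTheory GRing.Theory Num.Theory.
Import numFieldNormedType.Exports.
Local Open Scope classical_set_scope.
Local Open Scope ring_scope.

Section Defs.
Variable R : realType.

Local Notation pt := (R * R)%type.
Local Notation seqT := {ptws nat -> (R * R)%type}.
Local Notation Bor := (g_sigma_algebraType (@open seqT)).
Definition Borel (E : set seqT) : Prop := <<s @open seqT >> E.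

Definition Iint : set R := `[-1, 1].
Definition Jint : set R := `]1, 2].
Definition Disk : set pt := [set p | p.1 ^+ 2 + p.2 ^+ 2 <= 4].

Definition ft (t x : R) : R := Num.min (t * (x - 1) + 3) (t * (1 - x) - 1).

(** phi y s = the point of D with coordinates (y,s) in S x [0,1]: phi is the
    parametrisation induced by an embedding of the mapping cylinder of
    y |-> cos y onto D, with (y,0) = y in S (circle of radius 2, angle y). *)
Definition cyl_param (phi : R -> R -> pt) : Prop :=
  (forall y, phi y 0 = (2 * cos y, 2 * sin y)) /\
  (forall y s, phi (y + 2 * pi) s = phi y s) /\
  {within [set p : pt | 0 <= p.2 <= 1], continuous (fun p : pt => phi p.1 p.2)} /\
  (forall y y' s s', 0 <= y < 2 * pi -> 0 <= y' < 2 * pi ->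
     0 <= s <= 1 -> 0 <= s' <= 1 ->
     (phi y s = phi y' s' <->
      ((y = y' /\ s = s') \/ (s = 1 /\ s' = 1 /\ cos y = cos y')))) /\
  [set q | exists y s, 0 <= s <= 1 /\ phi y s = q] = Disk.

Definition iota (phi : R -> R -> pt) (x : R) : pt := phi (acos x) 1.

Definition near_homeo (g : pt -> pt) : Prop :=
  forall e : R, 0 < e -> exists h hinv : pt -> pt,
    (forall z, Disk z ->
       Disk (h z) /\ Disk (hinv z) /\ hinv (h z) = z /\ h (hinv z) = z) /\
    {within Disk, continuous h} /\ {within Disk, continuous hinv} /\
    (forall z, Disk z -> ball (g z) e (h z)).

Definition is_Upsilon (phi : R -> R -> pt) (Ups : pt -> pt) : Prop :=
  forall y s, 0 <= s <= 1 -> Ups (phi y s) = phi y (Num.min (2 * s) 1).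

(** An unwrapping (with the extra assumption fb_t = id on S x [0,3/4]). *)
Definition unwrapping (phi : R -> R -> pt) (Ups : pt -> pt)
    (fb : R -> pt -> pt) : Prop :=
  {within [set p : R * pt | Jint p.1 /\ Disk p.2],
     continuous (fun p : R * pt => fb p.1 p.2)} /\
  forall t, Jint t ->
    (forall z, Disk z -> Disk (fb t z)) /\
    near_homeo (fb t) /\
    (forall x x', Iint x -> Iint x' ->
       fb t (iota phi x) = fb t (iota phi x') -> x = x') /\
    (forall x, Iint x -> exists y s, 1 / 2 <= s <= 1 /\ fb t (iota phi x) = phi y s) /\
    (forall x, Iint x -> Ups (fb t (iota phi x)) = iota phi (ft t x)) /\
    (forall y s, 0 <= s <= 1 / 2 -> exists y', fb t (phi y s) = phi y' s) /\
    (forall y s, 0 <= s <= 3 / 4 -> fb t (phi y s) = phi y s).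

Definition Dhat (H : pt -> pt) : set seqT :=
  [set z | forall n, Disk (z n) /\ H (z n.+1) = z n].

(** The inverse limit of (I, f_t) inside Dhat. *)
Definition Ihat (phi : R -> R -> pt) (H : pt -> pt) : set seqT :=
  [set z | Dhat H z /\ forall n, exists x, Iint x /\ z n = iota phi x].

Definition Hhat (H : pt -> pt) (z : seqT) : seqT :=
  fun n => if n is n'.+1 then z n' else H (z 0%N).

(** Psi_t : A = S x [0,oo) -> Dhat \ Ihat, with A coordinatised by (y,s). *)
Definition Psi (phi : R -> R -> pt) (H : pt -> pt) (p : R * R) : seqT :=
  let y := p.1 in let s := p.2 in
  if s < 1 then fun n => phi y (s / 2 ^+ n)
  else
    let k := Num.truncn s in
    let v := (s - k%:R + 1) / 2 in
    fun n => if (n < k)%N then iter (k - n) H (phi y v)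
             else phi y (v / 2 ^+ (n - k)).

Definition Adom : set (R * R) := [set p | 0 <= p.1 < 2 * pi /\ 0 <= p.2].

(** m: probability measure on A, dm = (1/K) dy d(arctan s)
    = (1/K) (1+s^2)^-1 dy ds, K = pi^2. *)
Definition m_A (B : set (R * R)) : \bar R :=
  ((pi ^+ 2)^-1)%:E *
  \int[(@lebesgue_measure R) \x (@lebesgue_measure R)]_(p in B `&` Adom)
     ((1 + p.2 ^+ 2)^-1)%:E.

Definition rho' (phi : R -> R -> pt) (H : pt -> pt) (E : set seqT) : \bar R :=
  m_A (Psi phi H @^-1` (E `\` Ihat phi H)).

Definition mfd_interior (Y : set seqT) (x : seqT) : Prop :=
  exists (O : set seqT) (V : set pt) (f : seqT -> pt) (g : pt -> seqT),
    open O /\ O x /\ open V /\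
    (forall z, (O `&` Y) z -> V (f z) /\ g (f z) = z) /\
    (forall w, V w -> (O `&` Y) (g w) /\ f (g w) = w) /\
    {within O `&` Y, continuous f} /\ {within V, continuous g}.

Definition mfd_boundary (Y : set seqT) : set seqT :=
  [set x | Y x /\ ~ mfd_interior Y x].

Definition borel_probability_on (Y : set seqT) (rho : set seqT -> \bar R) : Prop :=
  [/\ rho set0 = 0%E,
      (forall E, Borel E -> E `<=` Y -> (0 <= rho E)%E),
      (forall F : nat -> set seqT,
         (forall i, Borel (F i) /\ F i `<=` Y) -> trivIset setT F ->
         (fun n => \sum_(0 <= i < n) rho (F i))%E @ \oo --> rho (\bigcup_n F n)) &
      rho Y = 1%E].

Definition oxtoby_ulam (Y : set seqT) (rho : set seqT -> \bar R) : Prop :=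
  [/\ borel_probability_on Y rho,
      (forall x, Y x -> rho [set x] = 0%E),
      (forall O, open O -> (O `&` Y) !=set0 -> (0 < rho (O `&` Y))%E) &
      rho (mfd_boundary Y) = 0%E].

Definition acip (t : R) (mu : probability R R) : Prop :=
  [/\ mu Iint = 1%E,
      (forall A, measurable A -> (@lebesgue_measure R) A = 0%E -> mu A = 0%E) &
      (forall A, measurable A -> mu [set x | Iint x /\ A (ft t x)] = mu A)].

Definition natext_measure (phi : R -> R -> pt) (H : pt -> pt)
    (mu : probability R R) (muhat : probability Bor R) : Prop :=
  [/\ muhat (Dhat H : set Bor) = 1%E,
      (forall E : set seqT, Borel E ->
         muhat (Hhat H @^-1` E : set Bor) = muhat (E : set Bor)) &
      (forall (n : nat) (B : set pt), measurable B ->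
         muhat ((fun z : seqT => z n) @^-1` B : set Bor) =
         mu [set x | Iint x /\ B (iota phi x)])].

Definition regular_point (Y : set seqT) (F : seqT -> seqT) (nu : probability Bor R)
    (x : seqT) : Prop :=
  forall alpha : seqT -> R, {within Y, continuous alpha} ->
    (fun n : nat => n%:R^-1 * \sum_(i < n) alpha (iter i F x)) @ \oo -->
      Rintegral nu (Y : set Bor) (alpha : Bor -> R).

End Defs.

Notation Bor R := (g_sigma_algebraType (@open {ptws nat -> (R * R)%type})).

(* Main.v *)
(* Every point [Psi (y, s)] with [1 <= s <= 3/2] has first coordinate [iota (cos y)], so that the [n]-th
   coordinate of its orbit is eventually the tent map orbit of [cos y]. It is therefore regular as soon as
   [cos y] satisfies the conclusion of Birkhoff's theorem for countably many test functions, which are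
   uniformly dense in the continuous functions on the compact inverse limit. For the tent map, Birkhoff's
   theorem holds Lebesgue-almost everywhere, not only [mu]-almost everywhere: the slopes [t] and [- t]
   stretch intervals, which forces invariant sets to be Lebesgue-null or Lebesgue-conull. As the cosine is
   Lipschitz, it maps no null set of angles onto a conull subset of [-1, 1], so that the good angles [y]
   have positive measure.
   The Oxtoby-Ulam property follows from [Psi] being an injection, continuous on each slab
   [k <= s < k + 1], with dense image, which sends [s > 0] into the interior of the inverse limit. *)
Require Import Defs.
From HB Require Import structures.
From mathcomp Require Import all_boot all_order all_algebra.
From mathcomp Require Import all_classical all_reals all_analysis.
From mathcomp Require Import measurable_realfun ring lra.
Set Implicit Arguments.
Unset Strict Implicit.
Unset Printing Implicit Defensive.
Import Order.TTheory GRing.Theory Num.Theory.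
Import numFieldNormedType.Exports.
Local Open Scope classical_set_scope.
Local Open Scope ring_scope.

(** * Lebesgue ergodicity of the tent map *)

Section Tent.
Context {R : realType}.
Local Notation lam := (@lebesgue_measure R).

(** The hypotheses on [mu] do not include ergodicity, so that time averages have a common limit must
    come from the map itself. It is proved for Lebesgue measure and passes to [mu] by absolute
    continuity. Birkhoff's theorem is reduced to a one-sided statement: if [b] has negative
    integral, the sums of [b] along almost every orbit are bounded above. The set where they are not
    is invariant at every point, and if it were conull, a maximal function argument would make the
    integral nonnegative. Subtracting from a function slightly more than its mean, and
    symmetrically, yields the limit. A coordinate of a point of the inverse limit determines all
    earlier ones, so a continuous function there is nearly a function of one coordinate; its
    integral against [muhat] is then computed from the law of that coordinate, which is given by
    [mu]. The near-homeomorphism property rules out further preimages of low points. Hence one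
    coordinate of level below 1 determines the later ones too, which provides the charts of the
    inverse limit. *)

Lemma lebesgue_measure_affine (u v : R) (A : set R) : u != 0 -> measurable A ->
  (lam A = `|u|%:E * lam [set x | A (u * x + v)%R])%E.
Proof.
move=> u0 mA.
pose f := (fun x => u * x + v) : R -> measurableTypeR R.
have mf : measurable_fun setT f.
  by apply: measurable_funD => //; apply: measurable_funM.
pose nu : {measure set (measurableTypeR R) -> \bar R} :=
  mscale (NngNum (normr_ge0 u)) (measure_function_pushforward__canonical__measure_function_Measure lam mf).
(* The scaled pushforward is a measure, so it is enough to compare lengths of half-open intervals;
   for [u < 0] the preimage is open at the other end. *)
apply: (@lebesgue_measure_unique R nu) => //.
move=> _ [[a b]] _ <-.
rewrite /nu /= /mscale /= /pushforward /f /preimage /=.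
have [up|un] := ltrP 0 u.
  rewrite [X in _ = (_ * lam X)%E](_ : _ = `](a - v) / u, (b - v) / u]%classic).
    rewrite !lebesgue_measure_itv /= !lte_fin ltr_pM2r ?invr_gt0// ltrD2r.
    case: ifPn => _; last by rewrite mule0.
    by rewrite -!EFinB -EFinM; congr EFin; rewrite gtr0_norm//; field.
  apply/seteqP; split => x /=; rewrite !in_itv /= ltr_pdivrMr// ler_pdivlMr//;
    lra.
have {}un : u < 0 by rewrite lt_neqAle u0.
rewrite [X in _ = (_ * lam X)%E](_ : _ = `[(b - v) / u, (a - v) / u[%classic).
  rewrite !lebesgue_measure_itv /= !lte_fin ltr_nM2r ?invr_lt0// ltrD2r.
  case: ifPn => _; last by rewrite mule0.
  by rewrite -!EFinB -EFinM; congr EFin; rewrite ltr0_norm//; field.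
by apply/seteqP; split => x /=; rewrite !in_itv /= ltr_ndivlMr// ler_ndivrMr//;
  lra.
Qed.

(** The two branches meet at the turning point [1 - 2 / t], where both take the value 1. *)
Lemma ft_left (t x : R) : 1 < t -> x <= 1 - 2 / t -> ft t x = t * (x - 1) + 3.
Proof.
move=> t1 xc; rewrite /ft min_l//.
have : t * x <= t * (1 - 2 / t) by rewrite ler_pM2l; lra.
have -> : t * (1 - 2 / t) = t - 2 by field; lra.
lra.
Qed.

Lemma ft_right (t x : R) : 1 < t -> 1 - 2 / t <= x -> ft t x = t * (1 - x) - 1.
Proof.
move=> t1 xc; rewrite /ft min_r//.
have : t * (1 - 2 / t) <= t * x by rewrite ler_pM2l; lra.
have -> : t * (1 - 2 / t) = t - 2 by field; lra.
lra.
Qed.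

Lemma ft_Iint (t x : R) : Jint t -> Iint x -> Iint (ft t x).
Proof.
rewrite /Jint /Iint /= !in_itv /= => /andP[t1 t2] /andP[x1 x2].
have [xc|xc] := leP x (1 - 2 / t).
  rewrite ft_left//.
  have : t * x <= t * (1 - 2 / t) by rewrite ler_pM2l; lra.
  have -> : t * (1 - 2 / t) = t - 2 by field; lra.
  move=> h; apply/andP; split; nra.
rewrite ft_right//; last exact: ltW.
have : t * (1 - 2 / t) < t * x by rewrite ltr_pM2l; lra.
have -> : t * (1 - 2 / t) = t - 2 by field; lra.
move=> h; apply/andP; split; nra.
Qed.

Lemma iter_ft_Iint (t x : R) n : Jint t -> Iint x -> Iint (iter n (ft t) x).
Proof. by move=> tJ Ix; elim: n => //= n; exact: ft_Iint. Qed.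

Lemma measurable_ft (t : R) : measurable_fun setT (ft t).
Proof.
apply: measurable_minr; [apply: measurable_funD|apply: measurable_funB] => //;
  by apply: measurable_funM => //; exact: measurable_funB.
Qed.

Definition affine_on (f : R -> R) (k a b : R) := exists u v, `|u| = k /\
  forall x, a <= x <= b -> f x = u * x + v.

(** The breaks of the next iterate are the turning point and the preimages [(c - 3) / t + 1] and
    [1 - (c + 1) / t] of the old breaks [c] under the two branches. Preimages on the wrong side of
    the turning point only enlarge the list. *)
Lemma iter_ft_breaks (t : R) m : 1 < t -> exists B : seq R, forall a b, a <= b ->
  (forall c, c \in B -> ~~ (a < c < b)) ->
  affine_on (iter m (ft t)) (t ^+ m) a b.
Proof.
move=> t1; elim: m => [|m [B IH]].
  by exists [::] => a b _ _; exists 1, 0; split=> [|x _ /=]; rewrite ?normr1//; lra.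
exists ((1 - 2 / t) :: [seq (c - 3) / t + 1 | c <- B] ++ [seq 1 - (c + 1) / t | c <- B]).
move=> a b ab noB.
have Bl c : c \in B -> ~~ (a < (c - 3) / t + 1 < b).
  move=> cB; apply: noB; rewrite inE mem_cat; apply/orP; right; apply/orP; left.
  by apply/mapP; exists c.
have Br c : c \in B -> ~~ (a < 1 - (c + 1) / t < b).
  move=> cB; apply: noB; rewrite inE mem_cat; apply/orP; right; apply/orP; right.
  by apply/mapP; exists c.
have [bc|cb] := leP b (1 - 2 / t).
  have [||u [v [ut uv]]] := IH (t * (a - 1) + 3) (t * (b - 1) + 3).
  - by rewrite lerD2r ler_pM2l; lra.
  - move=> c /Bl; apply: contra => /andP[h1 h2].
    have e : t * ((c - 3) / t) = c - 3 by field; lra.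
    by apply/andP; split; rewrite -(ltr_pM2l (_ : 0 < t)); lra.
  exists (u * t), (u * (3 - t) + v); split.
    by rewrite normrM ut exprSr (ger0_norm (_ : 0 <= t)); lra.
  move=> x /andP[ax xb]; rewrite iterSr ft_left//; last lra.
  rewrite uv; first by ring.
  by apply/andP; split; rewrite lerD2r ler_pM2l; lra.
have ca : 1 - 2 / t <= a.
  rewrite leNgt; apply/negP => ac.
  by move: (noB (1 - 2 / t)); rewrite inE eqxx ac cb => /(_ isT).
have [||u [v [ut uv]]] := IH (t * (1 - b) - 1) (t * (1 - a) - 1).
- by rewrite lerD2r ler_pM2l; lra.
- move=> c /Br; apply: contra => /andP[h1 h2].
  have e : t * ((c + 1) / t) = c + 1 by field; lra.
  by apply/andP; split; rewrite -(ltr_pM2l (_ : 0 < t)); lra.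
exists (- (u * t)), (u * (t - 1) + v); split.
  by rewrite normrN normrM ut exprSr (ger0_norm (_ : 0 <= t)); lra.
move=> x /andP[ax xb]; rewrite iterSr ft_right//; last lra.
rewrite uv; first by ring.
by apply/andP; split; rewrite lerD2r ler_pM2l; lra.
Qed.

(** An interval shorter than [d] then contains at most one break of the iterate. *)
Lemma seq_gap (B : seq R) : exists2 d : R, 0 < d & forall c c', c \in B -> c' \in B ->
  c < c' -> d <= c' - c.
Proof.
elim: B => [|x B [d d0 IH]]; first by exists 1.
have [e e0 He] : exists2 e : R, 0 < e & forall c, c \in B -> c != x -> e <= `|c - x|.
  elim: B {IH} => [|y B [e e0 IH]]; first by exists 1.
  have [->|yx] := eqVneq y x.
    by exists e => // c; rewrite inE => /orP[/eqP ->|/IH//]; rewrite eqxx.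
  exists (Num.min e `|y - x|); first by rewrite lt_min e0 normr_gt0 subr_eq0.
  move=> c; rewrite inE => /orP[/eqP -> _|cB cx]; first by rewrite ge_min lexx orbT.
  by rewrite ge_min IH.
exists (Num.min d e); first by rewrite lt_min d0.
move=> c c'; rewrite !inE => /orP[/eqP->|cB] /orP[/eqP->|c'B] cc'; rewrite ge_min.
- by rewrite ltxx in cc'.
- by rewrite -(gtr0_norm (_ : 0 < c' - x)) ?subr_gt0// He ?orbT// gt_eqF.
- by rewrite -(gtr0_norm (_ : 0 < x - c)) ?subr_gt0// distrC He ?orbT// lt_eqF.
- by rewrite IH.
Qed.

End Tent.

(** * Invariant sets of the tent map: null or full near the turning point *)

Section LebesgueErgodic.
Context {R : realType}.
Local Notation lam := (@lebesgue_measure R).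
Variables (t : R) (E : set R).
Hypotheses (tJ : Jint t) (mE : measurable E).
Hypothesis invE : forall x, Iint x -> (E x <-> E (ft t x)).

Let t1 : 1 < t. Proof. by move: tJ; rewrite /Jint /= in_itv /= => /andP[]. Qed.

(** The set [E] is studied through what it misses: lower bounds for the missing measure add up over
    adjacent intervals ([co_split]), and [co a b = 0] says that [E] is full on the interval. *)
Let co a b := fine (lam (`[a, b] `\` E)).

Let mco (a b : R) : measurable (`[a, b] `\` E : set R).
Proof. exact: measurableD. Qed.

Let co_fin a b : lam (`[a, b] `\` E) = (co a b)%:E.
Proof.
rewrite /co fineK// ge0_fin_numE//.
apply: (@le_lt_trans _ _ (lam `[a, b])).
  by apply: le_measure; rewrite ?inE; [exact: mco|exact: measurable_itv|exact: subDsetl].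
by rewrite lebesgue_measure_itv /=; case: ifP => _; rewrite ?ltry// -EFinB ltry.
Qed.

Let co_ge0 a b : 0 <= co a b.
Proof. by rewrite -lee_fin -co_fin. Qed.

Let co_sub a b a' b' : a' <= a -> b <= b' -> co a b <= co a' b'.
Proof.
move=> aa bb; rewrite -lee_fin -!co_fin.
apply: le_measure; rewrite ?inE; [exact: mco|exact: mco|].
by apply: setSD => x /=; rewrite !in_itv /=; lra.
Qed.

Let co_split a c b : a <= c -> c <= b -> co a c + co c b <= co a b.
Proof.
move=> ac cb; rewrite -lee_fin EFinD -!co_fin.
have h : (lam (`[c, b] `\` E) <= lam (`]c, b] `\` E))%E.
  apply: (@le_trans _ _ (lam ([set c] `|` (`]c, b] `\` E))%E)).
    apply: le_measure; rewrite ?inE; first exact: mco.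
      by apply: measurableU => //; exact: measurableD.
    move=> x [/=]; rewrite in_itv /= le_eqVlt => /andP[/orP[/eqP ->|cx] xb] nE.
      by left.
    by right; split => //=; rewrite in_itv /= cx.
  have mc : measurable (`]c, b] `\` E : set R) by exact: measurableD.
  apply: (le_trans (measureU2 lam (measurable_set1 c) mc)).
  by rewrite /= lebesgue_measure_set1 add0e.
apply: (le_trans (leeD (le_refl _) h)).
rewrite -measureU//.
- apply: le_measure; rewrite ?inE.
  - by apply: measurableU; [exact: mco|exact: measurableD].
  - exact: mco.
  by move=> x [[/=]|[/=]]; rewrite !in_itv /= => /andP[h1 h2] h3;
    split => //; apply/andP; split; lra.
- exact: mco.
- exact: measurableD.
- apply/seteqP; split => x //= -[[/=]]; rewrite !in_itv /= => /andP[_ xc] _.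
  by case; lra.
Qed.

Let co_in a b : a <= b -> lam (`[a, b] `&` E) = (b - a - co a b)%:E.
Proof.
move=> ab; have mI : measurable (`[a, b] : set R) by exact: measurable_itv.
have : (lam `[a, b] = lam (`[a, b] `\` E) + lam (`[a, b] `&` E))%E := measureDI lam mI mE.
rewrite co_fin lebesgue_measure_itv /= lte_fin.
have -> : (if (a < b)%R then b%:E + (- a)%R%:E else 0)%E = (b - a)%:E.
  case: ltP => // ba; have -> : a = b by apply/eqP; rewrite eq_le ab.
  by rewrite subrr.
case: (lam (_ `&` _)) => [l||] //; rewrite -?EFinD => -[->].
by congr EFin; ring.
Qed.

Let invE_iter m x : Iint x -> (E x <-> E (iter m (ft t) x)).
Proof.
by elim: m x => [//|m IH] x Ix; rewrite iterSr invE// IH//; exact: ft_Iint.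
Qed.

(** By invariance, an affine branch of an iterate carries the complement of [E] in its domain
    exactly onto the complement of [E] in the image interval, so the missing measure is multiplied
    by the slope like the length. *)
Let co_affine m k a b : 0 < k -> -1 <= a -> a <= b -> b <= 1 ->
  affine_on (iter m (ft t)) k a b ->
  exists a' b', [/\ -1 <= a', a' <= b', b' <= 1, b' - a' = k * (b - a) &
    co a' b' = k * co a b].
Proof.
move=> k0 a1 ab b1 [u [v [uk uv]]].
have I2 x : a <= x <= b -> -1 <= u * x + v <= 1.
  move=> xab; rewrite -uv//; apply: iter_ft_Iint => //.
  rewrite /Iint /= in_itv /=; lra.
have u0 : u != 0 by rewrite -normr_gt0 uk.
have key a' b' : (forall x, a' <= u * x + v <= b' <-> a <= x <= b) ->
    co a' b' = k * co a b.
  move=> h; apply: EFin_inj; rewrite EFinM -!co_fin.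
  rewrite (lebesgue_measure_affine v u0)// uk; congr (_ * lam _)%E.
  apply/seteqP; split => x [/=]; rewrite !in_itv /=.
    move=> /h xab nE; split => //.
    move/(invE_iter m); rewrite uv// => /(_ _)/nE; apply.
    rewrite /Iint /= in_itv /=; lra.
  move=> xab nE; split; first exact/h.
  rewrite -uv//; have Ix : Iint x by rewrite /Iint /= in_itv /=; lra.
  by move/(invE_iter m Ix).
have [ia ib] : -1 <= u * a + v <= 1 /\ -1 <= u * b + v <= 1.
  by split; apply: I2; lra.
have [up|un] := ltrP 0 u.
  exists (u * a + v), (u * b + v); split; first by lra.
  - by rewrite lerD2r ler_pM2l.
  - by lra.
  - by rewrite -uk gtr0_norm//; ring.
  - by apply: key => x; rewrite !lerD2r !ler_pM2l.
have {}un : u < 0 by rewrite lt_neqAle u0.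
exists (u * b + v), (u * a + v); split; first by lra.
- by rewrite lerD2r ler_nM2l.
- by lra.
- by rewrite -uk ltr0_norm//; ring.
- by apply: key => x; rewrite !lerD2r !ler_nM2l// andbC.
Qed.

(* A short interval is cut into at most two pieces on which the [m]-th iterate is affine of slope at
   least [t ^+ m > 2]; hence the pieces not yet of length [d] after [n] rounds have total length at most
   [d * (2 / t ^+ m) ^+ n]. *)
Let co_ge : exists2 d, 0 < d & forall k, 0 <= k ->
  (forall a b, -1 <= a -> b <= 1 -> d <= b - a -> k * (b - a) <= co a b) ->
  forall a b, -1 <= a -> a <= b -> b <= 1 -> k * (b - a) <= co a b.
Proof.
have [m tm] : exists m, 2 < t ^+ m.
  have /cvgr_lt : t^-1 ^+ n @[n --> \oo] --> (0 : R).
    have tp : 0 < t := lt_trans ltr01 t1.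
    by apply: cvg_expr; rewrite ger0_norm ?invr_ge0 ?ltW// invf_lt1.
  move=> /(_ 2^-1 (ltac:(by rewrite invr_gt0)))[m _ /(_ m (leqnn _))] /=.
  by rewrite exprVn ltf_pV2 ?posrE ?exprn_gt0//; [exists m|exact: lt_trans ltr01 t1].
have [B HB] := iter_ft_breaks m t1.
have [d d0 Hd] := seq_gap B.
exists d => // k k0 Hk.
set r := 2 / t ^+ m.
have tm0 : 0 < t ^+ m by lra.
have r0 : 0 <= r by rewrite divr_ge0// ltW.
have step n a b : -1 <= a -> a <= b -> b <= 1 ->
    k * (b - a - d * r ^+ n) <= co a b.
  elim: n a b => [|n IH] a b a1 ab b1; have [dab|dab] := leP d (b - a).
  - apply: le_trans (Hk _ _ a1 b1 dab); rewrite ler_wpM2l// expr0; lra.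
  - by apply: le_trans (co_ge0 a b); rewrite mulr_ge0_le0// expr0; lra.
  - apply: le_trans (Hk _ _ a1 b1 dab); rewrite ler_wpM2l//.
    by rewrite gerBl mulr_ge0 ?exprn_ge0// ltW.
  have piece a' b' : a <= a' -> a' <= b' -> b' <= b ->
      (forall c, c \in B -> ~~ (a' < c < b')) ->
      k * (b' - a' - d * (r ^+ n / t ^+ m)) <= co a' b'.
    move=> aa ab' bb /(HB _ _ ab') /(co_affine tm0)[]; try lra.
    move=> p [q [p1 pq q1 qp cE]].
    rewrite -(ler_pM2l tm0) -cE; apply: le_trans (IH _ _ p1 pq q1).
    rewrite qp le_eqVlt; apply/orP; left; apply/eqP; field; lra.
  have [c [ac cb Bac Bcb]] : exists c, [/\ a <= c, c <= b,
      (forall c', c' \in B -> ~~ (a < c' < c)) &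
      (forall c', c' \in B -> ~~ (c < c' < b))].
    have [/hasP[c cB /andP[ac cb]]|/hasPn noc] := boolP (has (fun c => a < c < b) B).
      exists c; split; rewrite ?ltW// => c' c'B; apply/negP => /andP[h1 h2].
        by have := Hd _ _ c'B cB h2; lra.
      by have := Hd _ _ cB c'B h1; lra.
    (* Without a break inside, the first piece degenerates to the point [a]. *)
    by exists a; split => // c' c'B; apply/negP; lra.
  have := piece _ _ (lexx a) ac cb Bac; have := piece _ _ ac cb (lexx b) Bcb.
  have := co_split ac cb.
  have -> : r ^+ n.+1 = 2 * (r ^+ n / t ^+ m) by rewrite exprS /r; field; lra.
  move=> ? ? ?; nra.
move=> a b a1 ab b1.
have rn : r ^+ n @[n --> \oo] --> (0 : R).
  apply: cvg_expr; rewrite ger0_norm// /r ltr_pdivrMr//; lra.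
have lim : k * (b - a - d * r ^+ n) @[n --> \oo] --> k * (b - a - d * 0).
  apply: cvgMl_tmp; apply: cvgB; first exact: cvg_cst.
  by apply: cvgMl_tmp.
rewrite mulr0 subr0 in lim.
rewrite -(cvg_lim _ lim)//; apply: limr_le; first by apply/cvg_ex; eexists; exact: lim.
by near=> n; exact: step.
Unshelve. all: by end_near. Qed.

(** If no interval were full, [E] would miss a positive amount of every cell of a finite grid of
    mesh [d / 2], hence a fixed proportion of every interval of length at least [d]. By [co_ge] it
    would miss the same proportion of all shorter intervals, so [E] would have no density point
    inside [[-1, 1]] and would be null there. *)
Let full_interval : lam (@Iint R `&` E) != 0%E ->
  exists a b, [/\ -1 <= a, a < b, b <= 1 & co a b = 0].
Proof.
have [d d0 Hd] := co_ge.
move=> IE0; apply: contrapT => nex.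
have co0 a b : -1 <= a -> a < b -> b <= 1 -> 0 < co a b.
  move=> a1 ab b1; rewrite lt_neqAle co_ge0 andbT; apply/eqP => h.
  by apply: nex; exists a, b.
have grid M : exists2 e : R, 0 < e & forall j, (j < M)%N ->
    -1 + j.+1%:R * (d / 2) <= 1 ->
    e <= co (-1 + j%:R * (d / 2)) (-1 + j.+1%:R * (d / 2)).
  elim: M => [|M [e e0 IH]]; first by exists 1.
  have [h|h] := leP (-1 + M.+1%:R * (d / 2)) 1.
    exists (Num.min e (co (-1 + M%:R * (d / 2)) (-1 + M.+1%:R * (d / 2)))).
      rewrite lt_min e0 co0//; last by rewrite -[M.+1%:R]natr1; lra.
      by rewrite lerDl mulr_ge0//; lra.
    move=> j; rewrite ltnS leq_eqVlt => /orP[/eqP->|jM] hj.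
      by rewrite ge_min lexx orbT.
    by rewrite ge_min IH.
  exists e => // j; rewrite ltnS leq_eqVlt => /orP[/eqP->|jM] hj; first lra.
  exact: IH.
have [e e0 He] := grid (Num.truncn (2 / (d / 2))).+1.
(* The cell following the one that contains [a] starts to the right of [a] and ends by [a + d],
   hence lies in the interval. The factor is [e / 2] because the length is at most 2. *)
have big a b : -1 <= a -> b <= 1 -> d <= b - a -> e / 2 * (b - a) <= co a b.
  move=> a1 b1 ab.
  have z0 : 0 <= (a + 1) / (d / 2) by apply: divr_ge0; lra.
  have /andP[j1 j2] := truncn_itv z0.
  set j := Num.truncn _ in j1 j2.
  have h1 : j%:R * (d / 2) <= a + 1 by rewrite -ler_pdivlMr//; lra.
  have h2 : a + 1 < j.+1%:R * (d / 2) by rewrite -ltr_pdivrMr//; lra.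
  have h3 : j.+2%:R * (d / 2) = j%:R * (d / 2) + d by rewrite -[j.+2%:R]natr1 -[j.+1%:R]natr1; lra.
  have h4 : j.+1%:R * (d / 2) = j%:R * (d / 2) + d / 2 by rewrite -[j.+1%:R]natr1; lra.
  apply: (@le_trans _ _ e); first by nra.
  apply: le_trans (He j.+1 _ _) _.
  - rewrite ltnS truncn_ge_nat; last by rewrite divr_ge0//; lra.
    rewrite ler_pdivlMr; lra.
  - lra.
  - by apply: co_sub; lra.
have k0 : 0 < e / 2 by rewrite divr_gt0.
have {Hd big} co_all := Hd _ (ltW k0) big.
set k := e / 2 in k0 co_all.
move/eqP: IE0; apply.
have mIE : measurable (@Iint R `&` E : set R).
  by apply: measurableI => //; exact: measurable_itv.
have [N [mN N0 HN]] := lebesgue_density mIE.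
have mN2 : measurable (N `|` ([set -1] `|` [set 1])).
  by apply: measurableU => //; apply: measurableU; exact: measurable_set1.
apply/eqP; rewrite -measure_le0.
apply: (@le_trans _ _ (lam (N `|` ([set -1] `|` [set 1])))).
  apply: le_measure; rewrite ?inE//.
  move=> x [Ix Ex]; have [->|x1] := eqVneq x (-1); first by right; left.
  have [->|x2] := eqVneq x 1; first by right; right.
  left; apply: HN => /= H.
  move: Ix; rewrite /Iint /= in_itv /= => /andP[Ix1 Ix2].
  have {x1}Ix1 : -1 < x by rewrite lt_neqAle eq_sym x1.
  have {x2}Ix2 : x < 1 by rewrite lt_neqAle x2.
  (* The proportion found is at most [1 - k]; giving away [k / 2] leaves a strict inequality. *)
  have : ((\1_(@Iint R `&` E) x)%:E <= (1 - k / 2)%:E)%E.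
    apply: (cvge_to_le H); near=> r.
    have r0 : 0 < r by near: r; exact: nbhs_right_gt.
    have rx1 : r < x + 1 by near: r; apply: nbhs_right_lt; lra.
    have rx2 : r < 1 - x by near: r; apply: nbhs_right_lt; lra.
    rewrite lebesgue_measure_ball ?ltW// inver mulrn_eq0 /= gt_eqF//.
    rewrite lte_pdivrMr ?mulrn_wgt0//.
    have mI : measurable (`[x - r, x + r] : set R) by exact: measurable_itv.
    apply: (@le_lt_trans _ _ (lam (`[x - r, x + r] `&` E))).
      apply: le_measure; rewrite ?inE.
      - by apply: measurableI => //; exact: measurable_ball.
      - exact: measurableI.
      - move=> z [[_ Ez]]; rewrite /ball /= ltr_norml => zb; split => //=.
        by rewrite in_itv /=; lra.
    have xr : x - r <= x + r by lra.
    rewrite (co_in xr) -EFinM lte_fin.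
    have := co_all (x - r) (x + r).
    move=> /(_ ltac:(lra) ltac:(lra) ltac:(lra)).
    have -> : r *+ 2 = r + r by rewrite mulr2n.
    have : 0 < k * r by exact: mulr_gt0.
    by set c := co _ _ => kr cl; lra.
  rewrite indicE mem_set ?lee_fin /=; last first.
    by split => //; rewrite /Iint /= in_itv /= !ltW.
  lra.
apply: (le_trans (measureU2 lam mN _)) => //.
  by apply: measurableU; exact: measurable_set1.
rewrite -[leRHS]add0e; apply: leeD; first by rewrite le_eqVlt; apply/orP; left; apply/eqP.
apply: (le_trans (measureU2 lam _ _)); do ?exact: measurable_set1.
by rewrite -[leRHS]add0e; apply: leeD; rewrite le_eqVlt; apply/orP; left; apply/eqP;
  exact: lebesgue_measure_set1.
Unshelve. all: by end_near.
Qed.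

(* The image of a full interval is a full interval which is longer by the factor [t], until it contains
   the turning point. *)
Let full_turning : lam (@Iint R `&` E) != 0%E ->
  exists a b, [/\ -1 <= a, a < 1 - 2 / t, 1 - 2 / t < b, b <= 1 & co a b = 0].
Proof.
have t0 : 0 < t := lt_trans ltr01 t1.
move=> /full_interval[a [b [a1 ab b1 cE]]].
have grow n : (exists a b, [/\ -1 <= a, a < 1 - 2 / t, 1 - 2 / t < b, b <= 1 & co a b = 0]) \/
    exists a' b', [/\ -1 <= a', b' <= 1, t ^+ n * (b - a) <= b' - a' & co a' b' = 0].
  elim: n => [|n [|[p [q [p1 q1 pq cpq]]]]]; [|by left|].
    by right; exists a, b; split; rewrite ?mul1r.
  have pq' : p < q.
    by rewrite -subr_gt0; apply: lt_le_trans pq; rewrite mulr_gt0 ?exprn_gt0// subr_gt0.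
  have [cq|cq] := leP q (1 - 2 / t); last have [pc|pc] := leP (1 - 2 / t) p; last first.
  - by left; exists p, q.
  - right; have [|p' [q' [? ? ? e1 e2]]] := @co_affine 1 t p q t0 p1 (ltW pq') q1.
      exists (- t), (t - 1); split; first by rewrite normrN gtr0_norm.
      by move=> x /andP[h1 h2] /=; rewrite ft_right//; [ring|lra].
    exists p', q'; split => //; last by rewrite e2 cpq mulr0.
    by rewrite e1 exprS -mulrA ler_wpM2l// ltW.
  - right; have [|p' [q' [? ? ? e1 e2]]] := @co_affine 1 t p q t0 p1 (ltW pq') q1.
      exists t, (3 - t); split; first by rewrite gtr0_norm.
      by move=> x /andP[h1 h2] /=; rewrite ft_left//; [ring|lra].
    exists p', q'; split => //; last by rewrite e2 cpq mulr0.
    by rewrite e1 exprS -mulrA ler_wpM2l// ltW.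
(* An interval longer than 2 does not fit into [[-1, 1]], so for this [n] only the first alternative
   of [grow] remains. *)
have [n tn] : exists n, 2 < t ^+ n * (b - a).
  have /cvgr_lt : t^-1 ^+ n @[n --> \oo] --> (0 : R).
    by apply: cvg_expr; rewrite ger0_norm ?invr_ge0 ?ltW// invf_lt1.
  have ba : 0 < (b - a) / 2 by lra.
  move=> /(_ _ ba)[n _ /(_ n (leqnn _))] /=.
  by rewrite exprVn ltr_pdivlMr// ltr_pdivrMl ?exprn_gt0//; exists n.
by case: (grow n) => // -[p [q [p1 q1 pq _]]]; lra.
Qed.

Lemma invariant_full_near_turning : lam (@Iint R `&` E) != 0%E ->
  exists2 e, 0 < e & forall a b, 1 - 2 / t - e <= a -> b <= 1 - 2 / t + e ->
    lam (`[a, b] `\` E) = 0%E.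
Proof.
move=> /full_turning[a [b [a1 ac cb b1 cE]]].
exists (Num.min (1 - 2 / t - a) (b - (1 - 2 / t))).
  by rewrite lt_min !subr_gt0 ac.
move=> a' b' h1 h2; rewrite co_fin; congr EFin; apply/eqP.
rewrite eq_le co_ge0 andbT -cE; apply: co_sub.
  by apply: le_trans h1; rewrite lerBrDl -lerBrDr ge_min lexx.
by apply: le_trans h2 _; rewrite -lerBrDl ge_min lexx orbT.
Qed.

End LebesgueErgodic.

(** If neither [E] nor its complement were null, both would be full on one interval around the
    turning point, which would then have measure zero. *)
Lemma ft_lebesgue_ergodic {R : realType} (t : R) (E : set R) :
  Jint t -> measurable E -> (forall x, Iint x -> (E x <-> E (ft t x))) ->
  @lebesgue_measure R (@Iint R `&` E) = 0%E \/
  @lebesgue_measure R (@Iint R `&` ~` E) = 0%E.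
Proof.
move=> tJ mE invE.
have [->|E0] := eqVneq (lebesgue_measure (@Iint R `&` E)) 0%E; first by left.
have [->|E1] := eqVneq (lebesgue_measure (@Iint R `&` ~` E)) 0%E; first by right.
have invEc x : Iint x -> ((~` E) x <-> (~` E) (ft t x)).
  by move=> Ix; split => /= nE /(invE _ Ix).
have [e e0 He] := invariant_full_near_turning tJ mE invE E0.
have [e' e0' He'] := invariant_full_near_turning tJ (measurableC mE) invEc E1.
pose d := Num.min e e'; pose c := 1 - 2 / t.
have d0 : 0 < d by rewrite lt_min e0.
have de : d <= e by rewrite ge_min lexx.
have de' : d <= e' by rewrite ge_min lexx orbT.
have mJ : measurable (`[c - d, c + d] : set R) by exact: measurable_itv.
have : (lebesgue_measure `[(c - d)%R, (c + d)%R] = lebesgue_measure (`[(c - d)%R, (c + d)%R] `\` E) +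
   lebesgue_measure (`[(c - d)%R, (c + d)%R] `\` ~` E))%E.
  by rewrite (setDE _ (~` E)) setCK; exact: (measureDI (@lebesgue_measure R) mJ mE).
rewrite (He (c - d) (c + d)); [|rewrite /c; lra|rewrite /c; lra].
rewrite (He' (c - d) (c + d)); [|rewrite /c; lra|rewrite /c; lra].
rewrite add0e lebesgue_measure_itv /= lte_fin ifT; last lra.
by move=> [h]; exfalso; lra.
Qed.

(** * Birkhoff averages of the tent map *)

Section Birkhoff.
Context d (X : measurableType d) (R : realType) (P : probability X R).

Lemma bounded_integrable (D : set X) (g : X -> R) (C : R) : measurable D ->
  measurable_fun D g -> (forall x, D x -> `|g x| <= C) -> P.-integrable D (EFin \o g).
Proof.
move=> mD mg gC; apply: measurable_bounded_integrable => //.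
  by apply: le_lt_trans (probability_le1 P mD) _; rewrite ltry.
by exists C; split; [exact: num_real|move=> y Cy x Dx; exact: le_trans (gC x Dx) (ltW Cy)].
Qed.

Variable f : X -> X.
Hypotheses (mf : measurable_fun setT f)
  (Pf : forall A, measurable A -> P (f @^-1` A) = P A).

Lemma Rintegral_invariant (g : X -> R) (C : R) : measurable_fun setT g ->
  (forall x, `|g x| <= C) -> (\int[P]_x g (f x) = \int[P]_x g x)%R.
Proof.
move=> mg gC; rewrite /Rintegral; congr fine.
transitivity (\int[pushforward P f]_y (EFin \o g) y)%E.
  rewrite (integral_pushforward mf) ?preimage_setT//; first exact/measurable_EFinP.
  by apply: bounded_integrable => //; exact: measurableT_comp mg mf.
by apply: eq_measure_integral => A mA _; exact: Pf.
Qed.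

Variables (b : X -> R) (C : R).
Hypotheses (mb : measurable_fun setT b) (bC : forall x, `|b x| <= C).

(** The maximum of the partial sums with 0 to [n] terms along the orbit, in the recursive form on
    which the maximal ergodic theorem rests. *)
Fixpoint max_sum (n : nat) (x : X) : R :=
  if n is n'.+1 then Num.max 0 (b x + max_sum n' (f x)) else 0.

Let max_sum_ge0 n x : 0 <= max_sum n x.
Proof. by case: n => //= n; rewrite le_max lexx. Qed.

Let max_sum_leS n x : max_sum n x <= max_sum n.+1 x.
Proof.
elim: n x => [|n IH] x; first by rewrite /= le_max lexx.
rewrite [leLHS]/= [leRHS]/= ge_max !le_max lexx /=.
by rewrite lerD2l IH orbT.
Qed.

Let max_sum_homo x m n : (m <= n)%N -> max_sum m x <= max_sum n x.
Proof.
move=> mn; rewrite -(subnK mn); elim: (n - m)%N => [|k IH]; first exact: lexx.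
by rewrite addSn; apply: le_trans IH (max_sum_leS _ _).
Qed.

Let max_sum_le n x : max_sum n x <= n%:R * C.
Proof.
have C0 : 0 <= C by exact: le_trans (bC x).
elim: n x => [|n IH] x /=; first by rewrite mul0r.
rewrite ge_max mulr_ge0//= -natr1 mulrDl mul1r addrC lerD//.
exact: le_trans (ler_norm _) (bC x).
Qed.

Let measurable_max_sum n : measurable_fun setT (max_sum n).
Proof.
elim: n => [|n IH] /=; first exact: measurable_cst.
by apply: measurable_maxr => //; apply: measurable_funD => //; exact: measurableT_comp IH mf.
Qed.

Let sum_le_max_sum n x : \sum_(i < n) b (iter i f x) <= max_sum n x.
Proof.
elim: n x => [|n IH] x; first by rewrite big_ord0.
rewrite big_ord_recl /= le_max; apply/orP; right; rewrite lerD2l.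
by under eq_bigr do rewrite -iterS iterSr; exact: IH.
Qed.

(** The sums at [x] and at [f x] differ by one bounded term, so this set is invariant at every point
    and not just up to a null set, as the ergodicity lemma demands. *)
Definition unbounded_sums : set X := [set x | forall k : nat, exists n, k%:R < max_sum n x].

Lemma measurable_unbounded_sums : measurable unbounded_sums.
Proof.
rewrite (_ : unbounded_sums = \bigcap_k \bigcup_n (max_sum n @^-1` `]k%:R, +oo[)).
  apply: bigcapT_measurable => k; apply: bigcupT_measurable => n.
  by rewrite -[X in measurable X]setTI; apply: measurable_max_sum => //; exact: measurable_itv.
apply/seteqP; split => x /= H k; first by move=> _; have [n Hn] := H k; exists n => //=; rewrite in_itv /= Hn.
by have [n _ /=] := H k I; rewrite in_itv /= andbT => Hn; exists n.
Qed.

Lemma unbounded_sums_invariant x : unbounded_sums x <-> unbounded_sums (f x).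
Proof.
have bx := bC x; have C0 : 0 <= C by exact: le_trans (bC x).
have [Kl Kr] : - C <= b x /\ b x <= C by apply/andP; rewrite -ler_norml.
have CK : C < (Num.truncn C).+1%:R by apply: truncnS_gt.
split => H k; have [[|n]] := H (k + (Num.truncn C).+1)%N; rewrite natrD.
- by move=> /=; rewrite ltNge addr_ge0.
- rewrite /= lt_max => /orP[|h]; first by rewrite ltNge addr_ge0.
  by exists n; lra.
- by move=> /=; rewrite ltNge addr_ge0.
- move=> h; exists n.+2.
  have -> : max_sum n.+2 x = Num.max 0 (b x + max_sum n.+1 (f x)) by [].
  by move: (max_sum n.+1 (f x)) h => M h; rewrite lt_max; apply/orP; right; lra.
Qed.

(* [max_sum n.+1 x - max_sum n (f x) = max (- max_sum n (f x)) (b x)] has nonnegative integral and is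
   eventually [b x] when the sums along the orbit of [x] are unbounded. *)
Lemma unbounded_sums_Rintegral_ge0 : P unbounded_sums = 1%E -> 0 <= (\int[P]_x b x)%R.
Proof.
move=> P1.
pose D n x := max_sum n.+1 x - max_sum n (f x).
have DE n x : D n x = Num.max (- max_sum n (f x)) (b x).
  rewrite /D /=; case: (leP 0 (b x + max_sum n (f x))) => h.
    by rewrite addrK; apply/esym/max_r; lra.
  by rewrite add0r; apply/esym/max_l; lra.
have DC n x : `|D n x| <= C.
  have := max_sum_ge0 n (f x); have := bC x; rewrite DE !ler_norml => /andP[b1 b2] M0.
  rewrite le_max b1 orbT /= ge_max b2 andbT; apply: le_trans (_ : 0 <= _); first by rewrite oppr_le0.
  exact: le_trans (bC x).
have mMf n : measurable_fun setT (fun x => max_sum n (f x)).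
  by apply: measurableT_comp mf; exact: measurable_max_sum.
have mD n : measurable_fun setT (D n) by apply: measurable_funB.
have Mb n x : `|max_sum n x| <= n%:R * C by rewrite ger0_norm.
have D0 n : 0 <= (\int[P]_x D n x)%R.
  have i1 := @bounded_integrable setT _ _ measurableT (measurable_max_sum n.+1) (fun x _ => Mb n.+1 x).
  have i2 := @bounded_integrable setT _ _ measurableT (mMf n) (fun x _ => Mb n (f x)).
  have i3 := @bounded_integrable setT _ _ measurableT (measurable_max_sum n) (fun x _ => Mb n x).
  rewrite RintegralB// (Rintegral_invariant (measurable_max_sum n) (Mb n)) subr_ge0.
  by apply: le_Rintegral.
have Dcvg : {ae P, forall x, setT x -> EFin (D n x) @[n --> \oo] --> EFin (b x)}.
  exists (~` unbounded_sums); split.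
  - by apply: measurableC; exact: measurable_unbounded_sums.
  - by have := probability_setC P measurable_unbounded_sums; rewrite P1 subee.
  - move=> x /= H; apply: contra_not H => Ux _.
    have /(_ (Num.truncn C).+1)[n0 Hn0] := (unbounded_sums_invariant x).1 Ux.
    apply: cvg_EFin; first by near=> n.
    apply: cvg_near_cst; near=> n; rewrite /= -/(D n x) DE; apply/max_r.
    have n0n : (n0 <= n)%N by near: n; exact: nbhs_infty_ge.
    have := max_sum_homo (f x) n0n; have := bC x; rewrite ler_norml => /andP[b1 _].
    have : C < (Num.truncn C).+1%:R by apply: truncnS_gt.
    lra.
have [] := @dominated_convergence _ _ _ P setT measurableT (fun n => EFin \o D n) (EFin \o b) (cst C%:E).
- by move=> n; exact/measurable_EFinP.
- exact/measurable_EFinP.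
- exact: Dcvg.
- by apply: (@bounded_integrable setT (cst C) `|C|) => //; exact: measurable_cst.
- by apply: aeW => x n _ /=; rewrite lee_fin.
move=> _ _ Hc.
have bint := @bounded_integrable setT _ _ measurableT mb (fun x _ => bC x).
rewrite /Rintegral; apply: fine_ge0; rewrite -(cvg_lim _ Hc)//.
apply: lime_ge; first by apply/cvg_ex; eexists; exact: Hc.
near=> n => /=; have := D0 n; rewrite /Rintegral => h.
have Dint := @bounded_integrable setT _ _ measurableT (mD n) (fun x _ => DC n x).
by rewrite -[leRHS]fineK ?lee_fin//; exact: integrable_fin_num.
Unshelve. all: by end_near. Qed.

Lemma bounded_sums x : ~ unbounded_sums x ->
  exists K : R, forall n, \sum_(i < n) b (iter i f x) <= K.
Proof.
move=> /existsNP[k /forallNP H]; exists k%:R => n.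
by apply: le_trans (sum_le_max_sum n x) _; rewrite leNgt; apply/negP.
Qed.

End Birkhoff.

(** The constant [K] may grow with the precision [j]; for fixed [j] it is absorbed by [n * (e / 2)]
    once [n] is large. *)
Lemma natr_cvg_bound (R : realType) (u : nat -> R) (c : R) :
  (forall j : nat, exists K : R, forall n : nat, `|u n - n%:R * c| <= K + n%:R * j.+1%:R^-1) ->
  (fun n : nat => n%:R^-1 * u n) @ \oo --> c.
Proof.
move=> H; apply/cvgrPdist_le => e e0.
pose j := Num.truncn (2 / e).
have [K HK] := H j.
have je : j.+1%:R^-1 <= e / 2.
  rewrite -[leRHS]invrK lef_pV2 ?posrE ?invr_gt0 ?divr_gt0// invf_div.
  by apply/ltW/truncnS_gt.
near=> n.
have n0 : (0 < n)%N by near: n; exact: nbhs_infty_gt.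
have n0' : 0 < n%:R :> R by rewrite ltr0n.
have Kn : K / (e / 2) < n%:R.
  apply: (@lt_trans _ _ (Num.truncn (K / (e / 2))).+1%:R); first exact: truncnS_gt.
  by rewrite ltr_nat; near: n; exact: nbhs_infty_gt.
rewrite distrC -(ler_pM2l n0') -{1}(ger0_norm (ltW n0')) -normrM mulrBr mulVKf ?gt_eqF//.
apply: le_trans (HK n) _.
rewrite ltr_pdivrMr ?divr_gt0// in Kn.
have -> : n%:R * e = n%:R * (e / 2) + n%:R * (e / 2) by field.
by rewrite lerD ?(ltW Kn)// ler_wpM2l// ltW.
Unshelve. all: by end_near. Qed.

(** * Almost everywhere convergence of tent map averages *)

Section TentBirkhoff.
Context {R : realType}.
Variables (t : R) (mu : probability R R).
Hypotheses (tJ : Jint t) (hmu : acip t mu).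

Lemma acip_Iint (A : set R) : measurable A -> mu A = mu (@Iint R `&` A).
Proof.
move=> mA; have mI : measurable (@Iint R) by exact: measurable_itv.
have [muI _ _] := hmu.
have muCI : mu (~` @Iint R) = 0%E.
  by have := probability_setC mu mI; rewrite muI subee.
have h : (mu A = mu (A `\` @Iint R) + mu (A `&` @Iint R))%E := measureDI mu mA mI.
suff h0 : mu (A `\` @Iint R) = 0%E by rewrite h h0 add0e setIC.
by apply: (subset_measure0 _ _ _ muCI); [exact: measurableD|exact: measurableC|move=> x []].
Qed.

Let mu_ft (A : set R) : measurable A -> mu (ft t @^-1` A) = mu A.
Proof.
move=> mA; rewrite acip_Iint; first by have [_ _] := hmu; exact.
by rewrite -[X in measurable X]setTI; apply: measurable_ft.
Qed.

(** By ergodicity the invariant set is Lebesgue-null or conull in [[-1, 1]]. If conull, it has full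
    [mu]-measure by absolute continuity, and then the integral of [b] could not be negative. *)
Let unbounded_null (b : R -> R) (C : R) : measurable_fun setT b ->
  (forall x, `|b x| <= C) -> (\int[mu]_x b x < 0)%R ->
  @lebesgue_measure R (@Iint R `&` unbounded_sums (ft t) b) = 0%E.
Proof.
move=> mb bC b0; have mE := measurable_unbounded_sums (measurable_ft t) mb.
have [//|N0] := ft_lebesgue_ergodic tJ mE (fun x _ => unbounded_sums_invariant (ft t) bC x).
suff P1 : mu (unbounded_sums (ft t) b) = 1%E.
  by have := unbounded_sums_Rintegral_ge0 (measurable_ft t) mu_ft mb bC P1; rewrite leNgt b0.
have mEc : measurable (~` unbounded_sums (ft t) b) by exact: measurableC.
have muEc : mu (~` unbounded_sums (ft t) b) = 0%E.
  rewrite acip_Iint//; have [_ + _] := hmu; apply => //.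
  by apply: measurableI => //; exact: measurable_itv.
by rewrite -[unbounded_sums _ _]setCK probability_setC// muEc sube0.
Qed.

(** For every [j] the functions [b - (c + 1/(j+1))] and [(c - 1/(j+1)) - b] have negative integral.
    Outside countably many null sets their orbit sums are bounded above, which bounds the sums of
    [b] from both sides up to a constant plus [n/(j+1)]. *)
Lemma tent_birkhoff (b : R -> R) (C : R) : measurable_fun setT b -> (forall x, `|b x| <= C) ->
  exists N : set R, [/\ measurable N, @lebesgue_measure R N = 0%E & forall x, Iint x -> ~ N x ->
    (fun n : nat => n%:R^-1 * \sum_(i < n) b (iter i (ft t) x)) @ \oo --> \int[mu]_x b x].
Proof.
move=> mb bC; set c := Rintegral _ _ _.
have C0 : 0 <= C by exact: le_trans (bC 0).
pose bp j x := b x - (c + j.+1%:R^-1).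
pose bm j x := (c - j.+1%:R^-1) - b x.
have mbp j : measurable_fun setT (bp j) by exact: measurable_funB.
have mbm j : measurable_fun setT (bm j) by exact: measurable_funB.
have bpC j x : `|bp j x| <= C + `|c + j.+1%:R^-1|.
  by rewrite (le_trans (ler_normB _ _))// lerD2r.
have bmC j x : `|bm j x| <= C + `|c - j.+1%:R^-1|.
  by rewrite (le_trans (ler_normB _ _))// addrC lerD2r.
have intb := @bounded_integrable _ _ _ mu setT _ _ measurableT mb (fun x _ => bC x).
have intc (k : R) : mu.-integrable setT (EFin \o cst k).
  by apply: (@bounded_integrable _ _ _ mu setT (cst k) `|k|) => //; exact: measurable_cst.
have icst (k : R) : \int[mu]_x k = k.
  by rewrite /Rintegral integral_cst//= probability_setT mule1.
have ibp j : \int[mu]_x bp j x < 0.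
  rewrite /bp RintegralB//; last exact: intc.
  by rewrite icst -/c opprD addrA subrr add0r oppr_lt0 invr_gt0.
have ibm j : \int[mu]_x bm j x < 0.
  rewrite /bm RintegralB//; last exact: intc.
  by rewrite icst -/c addrAC subrr add0r oppr_lt0 invr_gt0.
pose E (b' : R -> R) := @Iint R `&` unbounded_sums (ft t) b'.
have mE (b' : R -> R) : measurable_fun setT b' -> measurable (E b').
  move=> mb'; have h := measurable_unbounded_sums (measurable_ft t) mb'.
  by apply: measurableI => //; exact: measurable_itv.
have [N [mN N0 HN]] :
    (@lebesgue_measure R).-negligible (\bigcup_j (E (bp j) `|` E (bm j))).
  apply: negligible_bigcup => j; apply: negligibleU.
    by exists (E (bp j)); split; [exact: mE|exact: unbounded_null (bpC j) (ibp j)|].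
  by exists (E (bm j)); split; [exact: mE|exact: unbounded_null (bmC j) (ibm j)|].
exists N; split => // x Ix Nx; apply: natr_cvg_bound => j.
have Np : ~ unbounded_sums (ft t) (bp j) x.
  by move=> h; apply/Nx/HN; exists j => //; left.
have Nm : ~ unbounded_sums (ft t) (bm j) x.
  by move=> h; apply/Nx/HN; exists j => //; right.
have [K HK] := bounded_sums Np; have [K' HK'] := bounded_sums Nm.
exists (Num.max K K') => n.
have {HK} := HK n; have {HK'} := HK' n; rewrite /bp /bm.
rewrite !sumrB !sumr_const !card_ord mulrnDl -[c *+ n]mulr_natl -[_^-1 *+ n]mulr_natl.
move: (\sum_(i < n) _) (n%:R * c) (n%:R / _) => S A B h1 h2; rewrite ler_norml.
have : K <= Num.max K K' by rewrite le_max lexx.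
have : K' <= Num.max K K' by rewrite le_max lexx orbT.
by move: (Num.max K K') => M ? ?; apply/andP; split; lra.
Qed.

End TentBirkhoff.

(** * The disk as a mapping cylinder *)

Section WithinContinuity.
Context {X Y Z : topologicalType}.

Lemma continuous_within_comp (A : set X) (B : set Y) (h : X -> Y) (f : Y -> Z) :
  {within A, continuous h} -> (forall x, A x -> B (h x)) ->
  {within B, continuous f} -> {within A, continuous (f \o h)}.
Proof.
move=> /subspace_continuousP ch hAB /subspace_continuousP cf.
apply/subspace_continuousP => x Ax; apply: cvg_comp (cf _ (hAB _ Ax)).
move=> U /= hU; have chU : within A (nbhs x) (h @^-1` [set t | B t -> U t]) := ch x Ax _ hU.
change (nbhs x (fun z => A z -> U (h z))).
change (nbhs x (fun z => A z -> B (h z) -> U (h z))) in chU.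
by apply: filterS chU => z H Az; exact: H Az (hAB _ Az).
Qed.

Lemma closed_within_preimage (A : set X) (f : X -> Y) (B : set Y) :
  closed A -> {within A, continuous f} -> closed B -> closed (A `&` f @^-1` B).
Proof.
move=> cA /continuous_closedP cf /cf/closed_subspaceP[V cV VA].
by rewrite setIC -VA; exact: closedI.
Qed.

(* A continuous map from a compact set onto its image in a Hausdorff space is closed. *)
Lemma within_continuous_quotient (K : set X) (q : X -> Y) (G : X -> Z) (F : Y -> Z) :
  hausdorff_space Y -> compact K -> {within K, continuous q} ->
  {within K, continuous G} -> (forall x, K x -> F (q x) = G x) ->
  {within q @` K, continuous F}.
Proof.
move=> hY cK cq cG FG; apply/continuous_closedP => B cB.
apply/closed_subspaceP; exists (q @` (K `&` G @^-1` B)).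
  apply: compact_closed => //; apply: continuous_compact.
    by apply: continuous_subspaceW cq; exact: subIsetl.
  move: cG => /continuous_closedP /(_ _ cB) /closed_subspaceP[V cV VK].
  by rewrite setIC -VK setIC; exact: compact_closedI.
apply/seteqP; split => y /=.
  by move=> [[x [Kx Gx] <-] Hy]; split => //; rewrite /from_subspace FG.
by move=> [+ [x Kx xy]]; rewrite -xy => Fx; split; exists x => //; split => //; rewrite -FG.
Qed.

End WithinContinuity.
Arguments continuous_within_comp {X Y Z A B h f} _ _ _.

Lemma within_continuous_pair {X Y Z : topologicalType} (A : set X) (f : X -> Y) (g : X -> Z) :
  {within A, continuous f} -> {within A, continuous g} ->
  {within A, continuous (fun x => (f x, g x))}.
Proof.
move=> /subspace_continuousP cf /subspace_continuousP cg.
by apply/subspace_continuousP => x Ax; apply: cvg_pair; [exact: cf|exact: cg].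
Qed.

(** * The product topology on sequences of points of the plane *)

Section SequenceSpace.
Context {R : realType}.
Local Notation pt := (R * R)%type.
Local Notation seqT := {ptws nat -> (R * R)%type}.

Lemma continuous_coord (n : nat) : continuous (fun z : seqT => z n : pt).
Proof.
by move=> z; apply: (@pointwise_cvgP nat pt (nbhs z) z _).1.
Qed.

Lemma within_continuous_seq {X : topologicalType} (A : set X) (f : X -> seqT) :
  (forall n, {within A, continuous (fun x => f x n : pt)}) -> {within A, continuous f}.
Proof.
move=> cf; apply/subspace_continuousP => x Ax; apply/pointwise_cvgP => n.
by move: (cf n) => /subspace_continuousP; apply.
Qed.

Lemma open_box (z : seqT) (N : nat) (e : R) :
  open [set w : seqT | forall i, (i < N)%N -> ball (z i) e (w i)].
Proof.
elim: N => [|N IH].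
  by rewrite (_ : [set w | _] = setT); [exact: openT|apply/seteqP; split].
have -> : [set w : seqT | forall i, (i < N.+1)%N -> ball (z i) e (w i)] =
  [set w : seqT | forall i, (i < N)%N -> ball (z i) e (w i)] `&`
  (fun w : seqT => w N : pt) @^-1` (ball (z N) e).
  apply/seteqP; split => w /=.
    by move=> H; split => [i iN|]; apply: H => //; rewrite ltnS ltnW.
  by move=> [H1 H2] i; rewrite ltnS leq_eqVlt => /orP[/eqP->//|]; exact: H1.
apply: openI => //; apply: open_comp; first by move=> w _; exact: continuous_coord.
exact: ball_open.
Qed.

(** Otherwise one could choose, for each [n], a point outside [O] that is [1/(n+1)]-close to [z] in
    the first [n] coordinates; these points converge to [z] coordinatewise. *)
Lemma nbhs_box (z : seqT) (O : set seqT) : nbhs z O ->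
  exists N (e : R), 0 < e /\ forall w : seqT,
    (forall i, (i < N)%N -> ball (z i) e (w i)) -> O w.
Proof.
move=> zO; apply: contrapT => H.
have {}H (n : nat) : exists w : seqT,
    (forall i, (i < n)%N -> ball (z i) n.+1%:R^-1 (w i)) /\ ~ O w.
  apply: contrapT => /forallNP Hn; apply: H; exists n, n.+1%:R^-1; split => // w Hw.
  by apply: contrapT => nO; apply: (Hn w).
have [w Hw] := choice H.
have cw : w @ \oo --> z.
  apply/pointwise_cvgP => i; apply/cvg_ballP => e e0.
  suff h : \forall n \near \oo, ball (z i) e (w n i) by exact: h.
  near=> n; have [/(_ i) Hi _] := Hw n.
  apply: le_ball (Hi _); last by near: n; exact: nbhs_infty_gt.
  by apply: ltW; near: n; exact: near_infty_natSinv_lt (PosNum e0).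
have [n _ /(_ n (leqnn _))] := cw _ zO.
by have [] := Hw n.
Unshelve. all: by end_near. Qed.

End SequenceSpace.

Section Cylinder.
Context {R : realType}.
Local Notation pt := (R * R)%type.
Variable phi : R -> R -> pt.
Hypothesis hphi : cyl_param phi.

Let phi_per n y s : phi (y + n%:R * (2 * pi)) s = phi y s.
Proof.
have [_ [per _]] := hphi.
elim: n => [|n IH]; first by rewrite mul0r addr0.
by rewrite -natr1 mulrDl mul1r addrA per.
Qed.

Let cos_per n y : cos (y + n%:R * (2 * pi)) = cos y :> R.
Proof.
elim: n => [|n IH]; first by rewrite mul0r addr0.
by rewrite -natr1 mulrDl mul1r addrA [2 * pi]mulr_natl cosD2pi -[pi *+ 2]mulr_natl.
Qed.

Let tau0 : 0 < 2 * pi :> R. Proof. by rewrite mulr_gt0 ?pi_gt0. Qed.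

Lemma phi_reduce y : exists y0, [/\ 0 <= y0 < 2 * pi, forall s, phi y s = phi y0 s
  & cos y = cos y0].
Proof.
(* Full turns are added to make the angle nonnegative, since [truncn] is the floor only there; the
   surplus is removed afterwards. *)
pose n := (Num.truncn (`|y| / (2 * pi))).+1; pose y1 := y + n%:R * (2 * pi).
have y1_ge0 : 0 <= y1.
  have : `|y| / (2 * pi) < n%:R by exact: truncnS_gt.
  rewrite ltr_pdivrMr// /y1 => h; have := ler_norm (- y); rewrite normrN; lra.
have z0 : 0 <= y1 / (2 * pi) by rewrite divr_ge0// ltW.
have /andP[m1 m2] := truncn_itv z0; set m := Num.truncn _ in m1 m2.
rewrite ler_pdivlMr// in m1; rewrite ltr_pdivrMr// -natr1 mulrDl mul1r in m2.
have e1 : y1 = (y1 - m%:R * (2 * pi)) + m%:R * (2 * pi) by rewrite subrK.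
exists (y1 - m%:R * (2 * pi)); split; first by apply/andP; split; lra.
  by move=> s; rewrite -(phi_per n y) -/y1 {1}e1 phi_per.
by rewrite -(cos_per n y) -/y1 {1}e1 cos_per.
Qed.

Lemma Disk_phi y s : 0 <= s <= 1 -> Disk (phi y s).
Proof.
have [_ [_ [_ [_ /seteqP[sub _]]]]] := hphi.
by move=> s01; apply: sub; exists y, s.
Qed.

Lemma phi_eq1 y y' : cos y = cos y' -> phi y 1 = phi y' 1.
Proof.
have [a [a2 ae ac]] := phi_reduce y; have [b [b2 be bc]] := phi_reduce y'.
have [_ [_ [_ [inj _]]]] := hphi.
rewrite ac bc ae be => cab; apply/inj => //; rewrite ?ler01 ?lexx//; by right.
Qed.

(** Below level 1 the coordinates are unique up to full turns. Agreement of the angles is expressed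
    as equality of the two generating lines, which avoids arithmetic modulo [2 * pi]. *)
Lemma phi_eq y s y' s' : 0 <= s < 1 -> 0 <= s' <= 1 -> phi y s = phi y' s' ->
  s = s' /\ forall r, phi y r = phi y' r.
Proof.
have [a [a2 ae _]] := phi_reduce y; have [b [b2 be _]] := phi_reduce y'.
have [_ [_ [_ [inj _]]]] := hphi.
move=> /andP[s0 s1] s'01; rewrite ae be => /inj; rewrite s0 (ltW s1) => /(_ a2 b2 isT s'01).
move=> [[ab ss]|[se _]]; last by move: s1; rewrite se ltxx.
by split => // r; rewrite ae be ab.
Qed.

(** A choice of coordinates with no claim of continuity: on level 1 two angles may describe the same
    point, and the angle jumps at 0. The level does not depend on the choice. *)
Definition cyl (z : pt) : pt :=
  get [set p : pt | [/\ 0 <= p.1 < 2 * pi, 0 <= p.2 <= 1 & phi p.1 p.2 = z]].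

Lemma cylP z : Disk z -> [/\ 0 <= (cyl z).1 < 2 * pi, 0 <= (cyl z).2 <= 1
  & phi (cyl z).1 (cyl z).2 = z].
Proof.
move=> Dz; rewrite /cyl; apply: (@getPex pt [set p : pt | [/\ 0 <= p.1 < 2 * pi, 0 <= p.2 <= 1 & phi p.1 p.2 = z]]).
have [_ [_ [_ [_ /seteqP[_ sub]]]]] := hphi.
have [y [s [s01 e]]] := sub _ Dz.
by have [a [a2 ae _]] := phi_reduce y; exists (a, s); split => //=; rewrite -ae.
Qed.

Definition level (z : pt) : R := (cyl z).2.

Lemma level_phi y s : 0 <= s <= 1 -> level (phi y s) = s.
Proof.
move=> s01; have [c1 c2 e] := cylP (Disk_phi y s01); rewrite /level.
have /andP[s0 s1] := s01; have /andP[c0 c1'] := c2.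
have [sl|sg] := ltP s 1.
  by have [] := @phi_eq _ _ _ _ (introT andP (conj s0 sl)) c2 (esym e).
have [cl|cg] := ltP (cyl (phi y s)).2 1.
  by have [] := @phi_eq _ _ _ _ (introT andP (conj c0 cl)) s01 e.
by apply/eqP; rewrite eq_le (le_trans c1' sg) (le_trans s1 cg).
Qed.

Lemma level_bound z : Disk z -> 0 <= level z <= 1.
Proof. by move=> /cylP[]. Qed.

Lemma phi_level z : Disk z -> exists y, z = phi y (level z).
Proof. by move=> /cylP[_ _ e]; exists (cyl z).1. Qed.

(** The angle [2 * pi] is included, so that the rectangle is compact although [phi] identifies its
    two sides. *)
Definition strip (c : R) : set pt := `[0, 2 * pi] `*` `[0, c].

Lemma compact_strip c : compact (strip c).
Proof. by apply: compact_setX; exact: segment_compact. Qed.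

Lemma within_strip_phi c : c <= 1 -> {within strip c, continuous (fun p : pt => phi p.1 p.2)}.
Proof.
move=> c1; have [_ [_ [cphi _]]] := hphi; apply: continuous_subspaceW cphi => p [_ /=].
by rewrite in_itv /= => /andP[-> h] /=; exact: le_trans c1.
Qed.

Lemma phi_strip c : 0 <= c <= 1 ->
  (fun p : pt => phi p.1 p.2) @` strip c = [set z | Disk z /\ level z <= c].
Proof.
move=> /andP[c0 c1]; apply/seteqP; split => z /=.
  move=> [[y s] [_ /=]]; rewrite in_itv /= => /andP[s0 sc] <-.
  have s01 : 0 <= s <= 1 by rewrite s0 (le_trans sc).
  by split; [exact: Disk_phi|rewrite level_phi].
move=> [Dz lz]; have [/andP[y0 y2] /andP[s0 s1] e] := cylP Dz.
by exists (cyl z) => //; split; rewrite /= in_itv /= ?y0 ?s0 ?(ltW y2).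
Qed.

(** The sublevel set is a quotient of the compact strip, so a map given by a formula in the
    coordinates is continuous as soon as the formula is. This is how continuity is obtained without
    a continuous choice of angle. *)
Lemma level_le_continuous {Z : topologicalType} c (G : pt -> Z) (F : pt -> Z) :
  0 <= c <= 1 -> {within strip c, continuous G} ->
  (forall y s, 0 <= s <= c -> F (phi y s) = G (y, s)) ->
  {within [set z | Disk z /\ level z <= c], continuous F}.
Proof.
move=> c01 cG FG; rewrite -phi_strip//.
apply: (@within_continuous_quotient _ _ _ _ _ G) => //.
- exact: compact_strip.
- by apply: within_strip_phi; case/andP: c01.
- by move=> [y s] [_ /=]; rewrite in_itv /= => s0; exact: FG.
Qed.

Lemma Disk_levelE : [set z | Disk z /\ level z <= 1] = @Disk R.
Proof.
by apply/seteqP; split => z /=; [case|move=> Dz; split => //; have /andP[] := level_bound Dz].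
Qed.

Lemma continuous_level : {within @Disk R, continuous level}.
Proof.
rewrite -Disk_levelE; apply: (@level_le_continuous _ 1 snd); rewrite ?ler01 ?lexx//.
  by apply: continuous_subspaceT => x; exact: cvg_snd.
by move=> y s s01; rewrite level_phi.
Qed.

Lemma iota_cos y : Defs.iota phi (cos y) = phi y 1.
Proof.
by apply: phi_eq1; rewrite acosK// in_itv /= cos_geN1 cos_le1.
Qed.

(** The interval is the quotient of [[0, pi]] by the cosine, through which [phi] on level 1 factors;
    thus the behaviour of [acos] at the endpoints need not be examined. *)
Lemma within_continuous_iota : {within @Iint R, continuous (Defs.iota phi)}.
Proof.
have -> : @Iint R = cos @` `[0, pi].
  apply/seteqP; split => x /=.
    move=> Ix; exists (acos x); last by rewrite acosK.
    by move: Ix; rewrite /= !in_itv /= => Ix; rewrite acos_ge0// acos_lepi.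
  by move=> [y _ <-]; rewrite /Iint /= in_itv /= cos_geN1 cos_le1.
apply: (@within_continuous_quotient _ _ _ _ _ (fun y => phi y 1)).
- exact: Rhausdorff.
- exact: segment_compact.
- by apply: continuous_subspaceT => x; exact: continuous_cos.
- have [_ [_ [cphi _]]] := hphi.
  apply: (continuous_within_comp (h := fun y : R => (y, 1 : R)) _ _ cphi).
    by apply: within_continuous_pair; apply: continuous_subspaceT => x; [exact: cvg_id|exact: cvg_cst].
  by move=> y _ /=; rewrite ler01 lexx.
- by move=> y _; exact: iota_cos.
Qed.

(** A point of radius 2 has the form [phi y 0], hence level 0. The sets of positive level used as
    chart domains therefore avoid the bounding circle. *)
Lemma level_pos_lt (z : pt) : Disk z -> 0 < level z -> z.1 ^+ 2 + z.2 ^+ 2 < 4.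
Proof.
move=> Dz lz; rewrite lt_neqAle Dz andbT; apply/eqP => e.
have [phi0 _] := hphi.
have [y [y1 y2]] : exists y : R, cos y = z.1 / 2 /\ sin y = z.2 / 2.
  have h : (z.1 / 2) ^+ 2 + (z.2 / 2) ^+ 2 = 1 by rewrite !expr_div_n -mulrDl e; lra.
  have zb : -1 <= z.1 / 2 <= 1.
    have := sqr_ge0 (z.2 / 2); rewrite -(lerD2l ((z.1 / 2) ^+ 2)) addr0 h => h2.
    by apply/andP; split; nra.
  have ca : cos (acos (z.1 / 2)) = z.1 / 2 by rewrite acosK// in_itv.
  have : sin (acos (z.1 / 2)) ^+ 2 = (z.2 / 2) ^+ 2.
    by rewrite sin2cos2 ca; lra.
  move=> /eqP; rewrite eqf_sqr => /orP[/eqP sa|/eqP sa].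
    by exists (acos (z.1 / 2)).
  by exists (- acos (z.1 / 2)); rewrite cosN sinN ca sa opprK.
have : level z = 0.
  have -> : z = phi y 0.
    by rewrite phi0 y1 y2 [LHS]surjective_pairing; congr pair; lra.
  by rewrite level_phi// lexx ler01.
by move=> l0; rewrite l0 ltxx in lz.
Qed.

End Cylinder.

(** * The inverse limit and the parametrisation Psi *)

Section Unwrapping.
Context {R : realType}.
Local Notation pt := (R * R)%type.
Local Notation seqT := {ptws nat -> (R * R)%type}.
Variables (phi : R -> R -> pt) (Ups : pt -> pt) (fb : R -> pt -> pt) (t : R).
Hypotheses (hphi : cyl_param phi) (hUps : is_Upsilon phi Ups)
  (hfb : unwrapping phi Ups fb) (ht : Jint t).
Local Notation H := (Ups \o fb t).

Let fb_low y s : 0 <= s <= 3 / 4 -> fb t (phi y s) = phi y s.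
Proof. by have [_ /(_ t ht)[_ [_ [_ [_ [_ [_]]]]]]] := hfb; apply. Qed.

Let fb_Disk z : Disk z -> Disk (fb t z).
Proof. by have [_ /(_ t ht)[+ _]] := hfb; apply. Qed.

Lemma H_low y s : 0 <= s <= 3 / 4 -> H (phi y s) = phi y (Num.min (2 * s) 1).
Proof. by move=> s34 /=; rewrite fb_low// hUps//; lra. Qed.

Lemma H_iota x : Iint x -> H (Defs.iota phi x) = Defs.iota phi (ft t x).
Proof. by have [_ /(_ t ht)[_ [_ [_ [_ [+ _]]]]]] := hfb; apply. Qed.

Let min_bound (s : R) : 0 <= s -> 0 <= Num.min (2 * s) 1 <= 1.
Proof. by move=> s0; rewrite le_min ler01 ge_min lexx orbT !andbT mulr_ge0. Qed.

Lemma H_Disk z : Disk z -> Disk (H z).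
Proof.
move=> /fb_Disk Dz /=; have [y ->] := phi_level hphi Dz.
have /andP[l0 l1] := level_bound hphi Dz; rewrite hUps ?l0//.
by apply: Disk_phi => //; exact: min_bound.
Qed.

Lemma continuous_H : {within @Disk R, continuous H}.
Proof.
have [cfb _] := hfb; have [_ [_ [cphi _]]] := hphi.
have cpair : {within @Disk R, continuous (fun z : pt => (t, z))}.
  by apply: within_continuous_pair; apply: continuous_subspaceT => x; [exact: cvg_cst|exact: cvg_id].
have cft : {within @Disk R, continuous (fb t)}.
  by apply: (continuous_within_comp cpair _ cfb) => z Dz.
pose dbl (p : pt) : pt := (p.1, Num.min (2 * p.2) 1).
have cdbl : {within strip 1, continuous dbl}.
  apply: within_continuous_pair; apply: continuous_subspaceT => p; first exact: cvg_fst.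
  apply: (@continuous_min R _ (fun q : pt => 2 * q.2) (cst 1)); last exact: cvg_cst.
  by apply: cvgM; [exact: cvg_cst|exact: cvg_snd].
have cG : {within strip 1, continuous (fun p : pt => phi p.1 (Num.min (2 * p.2) 1))}.
  apply: (continuous_within_comp cdbl _ cphi).
  by move=> [y s] [_ /=]; rewrite in_itv /= => /andP[s0 _]; exact: min_bound.
have cUps : {within @Disk R, continuous Ups}.
  rewrite -(Disk_levelE hphi); apply: (@level_le_continuous _ _ hphi _ 1 _ _ _ cG).
    by rewrite ler01 lexx.
  by move=> y s s01 /=; rewrite hUps.
exact: (continuous_within_comp cft fb_Disk cUps).
Qed.

(* Near-homeomorphisms have connected fibres: if [fb t z = w] with [w] below height 1/2 and [z] above height
   3/4, the preimage of the segment [h z, h w] under a homeomorphism [h] close to [fb t] is a path from [z]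
   to [w] which [fb t] maps close to [w], but which meets the circle of height 3/5, fixed by [fb t]. *)
Let fb_lift z y s : Disk z -> 0 <= s < 1 / 2 -> fb t z = phi y s -> z = phi y s.
Proof.
move=> Dz /andP[s0 s2] fz; pose w := phi y s.
have Dw : Disk w by apply: Disk_phi => //; lra.
have fw : fb t w = w by apply: fb_low; lra.
have /andP[l0 l1] := level_bound hphi Dz.
have [l34|l34] := leP (level phi z) (3 / 4).
  by rewrite -fz; have [a ea] := phi_level hphi Dz; rewrite ea fb_low ?l0.
have := continuous_level hphi; move=> /subspace_continuousP /(_ w Dw) cl.
have lw : level phi w = s by rewrite /w level_phi//; lra.
have [e e0 He] : exists2 e : R, 0 < e & forall w', Disk w' -> ball w e w' -> level phi w' < 1 / 2.
  have hs : 0 < 1 / 2 - s by lra.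
  move/cvgr_dist_lt : cl => /(_ _ hs); rewrite near_withinE => /nbhs_ballP[e e0 He].
  exists e => // w' Dw' bw'; have := He w' bw' Dw'.
  rewrite /from_subspace lw ltr_norml => /andP[h _]; lra.
have e2 : 0 < e / 2 by rewrite divr_gt0.
have [_ /(_ t ht)[_ [nh _]]] := hfb.
have [h [hi [hD [ch [chi hb]]]]] := nh _ e2.
have [Dhz [_ [hiz _]]] := hD _ Dz; have [Dhw [_ [hiw _]]] := hD _ Dw.
pose seg (r : R) : pt := ((1 - r) * (h z).1 + r * (h w).1, (1 - r) * (h z).2 + r * (h w).2).
have Dseg r : 0 <= r <= 1 -> Disk (seg r).
  move=> /andP[r0 r1]; move: Dhz Dhw; rewrite /Disk /seg /=.
  move: (h z) (h w) => [a b] [c d] /= h1 h2.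
  have h3 : 0 <= r * (1 - r) * ((a - c) ^+ 2 + (b - d) ^+ 2).
    by apply: mulr_ge0; [apply: mulr_ge0 => //; rewrite subr_ge0|rewrite addr_ge0 ?sqr_ge0].
  have h4 : (1 - r) * (a ^+ 2 + b ^+ 2) <= (1 - r) * 4 by rewrite ler_wpM2l// subr_ge0.
  have h5 : r * (c ^+ 2 + d ^+ 2) <= r * 4 by rewrite ler_wpM2l.
  lra.
have segb r : 0 <= r <= 1 -> ball w (e / 2) (seg r).
  move=> /andP[r0 r1]; have := hb z Dz; have := hb w Dw; rewrite fz fw -/w.
  have conv (a b c : R) : `|a - b| < e / 2 -> `|a - c| < e / 2 ->
      `|a - ((1 - r) * b + r * c)| < e / 2.
    rewrite !ltr_norml; move: (e / 2) => d /andP[p1 p2] /andP[q1 q2].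
    have [r1'|r1'] := eqVneq r 1; first by rewrite r1'; apply/andP; split; lra.
    have {}r1' : 0 < 1 - r by rewrite subr_gt0 lt_neqAle r1'.
    have := ltr_pM2l r1' (- d) (a - b); have := ltr_pM2l r1' (a - b) d.
    have := ler_wpM2l r0 (ltW q1); have := ler_wpM2l r0 (ltW q2).
    rewrite p1 p2 => h1 h2 h3 h4; apply/andP; split; lra.
  move: (h z) (h w) @seg Dseg => [a b] [c d] seg _ [/= c1 c2] [/= a1 a2].
  rewrite /ball /= in c1 c2 a1 a2 *; split => /=; rewrite /ball /=; exact: conv.
pose g r := level phi (hi (seg r)).
have cg : {within `[0, 1], continuous g}.
  apply: (@continuous_within_comp _ _ _ _ (@Disk R) (fun r => hi (seg r))); last exact: continuous_level.
    apply: (@continuous_within_comp _ _ _ _ (@Disk R) seg _ _ _ chi).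
      apply: within_continuous_pair; apply: continuous_subspaceT => r;
      by apply: cvgD; apply: cvgM; do ?exact: cvg_cst; do ?exact: cvg_id; apply: cvgB; [exact: cvg_cst|exact: cvg_id].
    by move=> r; rewrite /= in_itv /=; exact: Dseg.
  by move=> r; rewrite /= in_itv /= => /Dseg /hD[_ []].
have seg0 : seg 0 = h z by rewrite /seg subr0 !mul1r !mul0r !addr0 -surjective_pairing.
have seg1 : seg 1 = h w by rewrite /seg subrr !mul1r !mul0r !add0r -surjective_pairing.
have g0 : g 0 = level phi z by rewrite /g seg0 hiz.
have g1 : g 1 = s by rewrite /g seg1 hiw.
have [|r] := @IVT R g 0 1 (3 / 5) ler01 cg.
  by rewrite g0 g1 ge_min le_max; apply/andP; split; apply/orP; [right|left]; lra.
rewrite in_itv /= => r01; rewrite /g; set c := hi (seg r) => lc.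
have [_ [Dc [_ hc]]] := hD _ (Dseg r r01); rewrite -/c in Dc hc.
have fc : fb t c = c by have [a ea] := phi_level hphi Dc; rewrite ea fb_low// lc; lra.
have : ball w e c.
  have := hb c Dc; rewrite fc hc => /ball_sym b2.
  by rewrite (splitr e); exact: ball_triangle (segb r r01) b2.
by move=> /(He c Dc); rewrite lc => h35; exfalso; lra.
Qed.

(** Below height 1/2 the map [Ups] just doubles the height, so [fb t z] is [phi y (s / 2)], which
    has no other preimage by [fb_lift]. The bound [s < 1] is essential, as [Ups] collapses
    everything above height 1/2 to level 1. *)
Lemma H_lift z y s : Disk z -> 0 <= s < 1 -> H z = phi y s -> z = phi y (s / 2).
Proof.
move=> Dz /andP[s0 s1] /= Uz; apply: fb_lift => //; first by lra.
have Dfz := fb_Disk Dz; have [a ea] := phi_level hphi Dfz.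
have /andP[l0 l1] := level_bound hphi Dfz.
rewrite ea hUps ?l0// in Uz.
have [|es er] := phi_eq hphi _ (min_bound l0) (esym Uz); first by rewrite s0.
rewrite ea er; congr (phi _ _); move: es; case: (leP (2 * level phi (fb t z)) 1) => h es; lra.
Qed.

Lemma iter_H_Disk k z : Disk z -> Disk (iter k H z).
Proof. by move=> Dz; elim: k => //= k; exact: H_Disk. Qed.

Lemma continuous_iter_H k : {within @Disk R, continuous (iter k H)}.
Proof.
elim: k => [|k IH]; first by apply: continuous_subspaceT => x; exact: cvg_id.
rewrite (_ : iter k.+1 H = iter k H \o H); last by apply/funext => x; rewrite iterSr.
exact: (continuous_within_comp continuous_H H_Disk IH).
Qed.

Lemma iter_H_iota k x : Iint x -> iter k H (Defs.iota phi x) = Defs.iota phi (iter k (ft t) x).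
Proof.
move=> Ix; elim: k => [//|k IH]; rewrite 2!iterS IH H_iota//; exact: iter_ft_Iint.
Qed.

Lemma H_half y s : 0 <= s <= 1 -> H (phi y (s / 2)) = phi y s.
Proof.
move=> s01; rewrite H_low; last lra.
by rewrite min_l; [congr (phi _ _)|]; lra.
Qed.

Lemma Dhat_iter z n k : Dhat H z -> iter k H (z (n + k)%N) = z n.
Proof.
move=> Dz; elim: k n => [|k IH] n; first by rewrite addn0.
by rewrite addnS -addSn iterS IH; exact: (Dz n).2.
Qed.

Lemma Dhat_lift z n k y s : Dhat H z -> 0 <= s < 1 -> z n = phi y s ->
  z (n + k)%N = phi y (s / 2 ^+ k).
Proof.
move=> Dz /andP[s0 s1] zn; elim: k => [|k IH]; first by rewrite addn0 expr0 divr1.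
rewrite addnS; have [Dn Hn] := Dz (n + k)%N.
have [Dn' _] := Dz (n + k).+1.
rewrite (H_lift Dn' _ (etrans Hn IH)); first by rewrite exprSr invfM mulrA.
have p0 : 0 < 2 ^+ k :> R by rewrite exprn_gt0.
rewrite divr_ge0 ?(ltW p0)//= ltr_pdivrMr// mul1r (lt_le_trans s1)// exprn_ege1//; lra.
Qed.

Lemma compact_Dhat : compact (Dhat H).
Proof.
have cD : compact (@Disk R).
  rewrite -(Disk_levelE hphi) -(phi_strip hphi); last by rewrite ler01 lexx.
  by apply: continuous_compact; [exact: within_strip_phi|exact: compact_strip].
pose P : set seqT := [set z | forall n, Disk (z n)].
have cP : compact P := @tychonoff nat (fun _ => pt) (fun _ => @Disk R) (fun _ => cD).
have clP : closed P.
  apply: compact_closed => //; apply: hausdorff_product => _; exact: norm_hausdorff.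
(* Continuity of [H] is available on the disk only, so each relation is turned into the preimage of
   the closed set [[set 0]] within the compact product of disks. *)
suff -> : Dhat H = P `&` \bigcap_n [set z : seqT | P z /\ H (z n.+1) - z n = 0].
  apply: compact_closedI => //; apply: closed_bigI => n _.
  apply: (@closed_within_preimage _ _ P (fun z : seqT => H (z n.+1) - z n) [set 0]) => //.
    apply/subspace_continuousP => z Pz.
    have h0 : {within P, continuous (fun z : seqT => z n.+1 : pt)}.
      by apply: continuous_subspaceT; exact: continuous_coord.
    have h1 : {within P, continuous (fun z : seqT => H (z n.+1))}.
      exact: (continuous_within_comp h0 (fun x Px => Px n.+1) continuous_H).
    have h2 : {within P, continuous (fun z : seqT => z n : pt)}.
      by apply: continuous_subspaceT; exact: continuous_coord.
    move: h1 h2 => /subspace_continuousP h1 /subspace_continuousP h2.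
    by apply: cvgB; [exact: h1|exact: h2].
  exact/accessible_closed_set1/hausdorff_accessible/norm_hausdorff.
apply/seteqP; split => z /=.
  move=> Dz; have Pz : P z by move=> n; exact: (Dz n).1.
  by split => // n _ /=; split => //; have := (Dz n).2; rewrite /= => ->; rewrite subrr.
by move=> [Pz Hz] n; split; [exact: Pz|have [_ /eqP] := Hz n I; rewrite subr_eq0 => /eqP].
Qed.

Lemma closed_Dhat : closed (Dhat H).
Proof.
apply: compact_closed; last exact: compact_Dhat.
by apply: hausdorff_product => _; exact: norm_hausdorff.
Qed.

Lemma Hhat_Dhat z : Dhat H z -> Dhat H (Hhat H z).
Proof.
move=> Dz [|n]; split; [exact/H_Disk/(Dz 0%N).1|by []|exact: (Dz n).1|exact: (Dz n).2].
Qed.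

Lemma iter_Hhat_Dhat k z : Dhat H z -> Dhat H (iter k (Hhat H) z).
Proof. by move=> Dz; elim: k => //= k; exact: Hhat_Dhat. Qed.

Lemma continuous_Hhat : {within Dhat H, continuous (Hhat H : seqT -> seqT)}.
Proof.
have cz n : {within Dhat H, continuous (fun z : seqT => z n : pt)}.
  by apply: continuous_subspaceT; exact: continuous_coord.
apply: within_continuous_seq => -[|n]; last exact: cz.
exact: (continuous_within_comp (cz 0%N) (fun z Dz => (Dz 0%N).1) continuous_H).
Qed.

Lemma continuous_iter_Hhat k : {within Dhat H, continuous (iter k (Hhat H) : seqT -> seqT)}.
Proof.
elim: k => [|k IH]; first by apply: continuous_subspaceT => x; exact: cvg_id.
exact: (continuous_within_comp IH (fun z => @iter_Hhat_Dhat k z) continuous_Hhat).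
Qed.

(** The map [Hhat] shifts the sequence and inserts the forward image in front, so coordinate [N]
    follows the orbit of [z 0] with a delay of [N] steps. *)
Lemma iter_Hhat_coord k N z : (N <= k)%N -> iter k (Hhat H) z N = iter (k - N) H (z 0%N).
Proof.
elim: N k => [|N IH] k; last by case: k => [//|k] Nk; rewrite iterS /= IH.
by move=> _; rewrite subn0; elim: k => //= k ->.
Qed.

(* The height [depth s / 2 ^+ n] of the [n]-th coordinate of [Psi (y, s)], for large [n]. *)
Definition depth (s : R) : R :=
  if s < 1 then s else (s - (Num.truncn s)%:R + 1) / 2 * 2 ^+ Num.truncn s.

Let pow2_gt0 n : 0 < 2 ^+ n :> R. Proof. by rewrite exprn_gt0. Qed.

Let truncn_lt1 (s : R) : 0 <= s -> s < 1 -> Num.truncn s = 0%N.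
Proof. by move=> s0 s1; apply/eqP; rewrite truncn_eq// s0. Qed.

(** For [k >= 1] the interval [[k, k + 1[] is mapped affinely onto [[2 ^ (k - 1), 2 ^ k[]. These
    pieces fit together, so [depth] is a bijection of the half-line [[0, +oo[]. *)
Lemma depth_linear (k : nat) (s : R) : k%:R <= s -> s < k.+1%:R ->
  depth s = if k is k'.+1 then 2 ^+ k' * (s - k%:R + 1) else s.
Proof.
move=> ks sk; have s0 : 0 <= s by apply: le_trans ks; rewrite ler0n.
have tk : Num.truncn s = k by apply/eqP; rewrite truncn_eq// ks.
rewrite /depth tk; case: k ks sk tk => [|k] ks sk tk; first by rewrite sk.
have s1 : 1 <= s by apply: le_trans ks; rewrite ler1n.
by rewrite ltNge s1 /= exprS; field.
Qed.

Lemma depth_bound s : 0 <= s -> 0 <= depth s < 2 ^+ Num.truncn s.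
Proof.
move=> s0; have /andP[k1 k2] := truncn_itv s0.
rewrite (depth_linear k1 k2); move: k1 k2; case: (Num.truncn s) => [|k] k1 k2.
  by rewrite expr0 s0.
rewrite -[k.+2%:R]natr1 in k2; rewrite exprS; have := pow2_gt0 k => p0.
by apply/andP; split; [apply: mulr_ge0; lra|rewrite mulrC ltr_pM2r//; lra].
Qed.

Lemma depth_gt0 s : 0 < s -> 0 < depth s.
Proof.
move=> s0; have /andP[k1 k2] := truncn_itv (ltW s0).
rewrite (depth_linear k1 k2); case: (Num.truncn s) k1 k2 => [//|k] k1 k2.
by rewrite mulr_gt0//; lra.
Qed.

Lemma depth_surj x : 0 <= x -> exists2 s, 0 <= s & depth s = x.
Proof.
move=> x0; have [x1|x1] := ltP x 1; first by exists x => //; rewrite /depth x1.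
have ex : exists k, x < 2 ^+ k.
  exists (Num.truncn x).+1; apply: lt_le_trans (truncnS_gt x) _.
  by rewrite -natrX ler_nat ltnW// ltn_expl.
case: (ex_minnP ex) => -[|k] xk mk; first by rewrite expr0 ltNge x1 in xk.
have kx : 2 ^+ k <= x by rewrite leNgt; apply/negP => /mk; rewrite ltnn.
pose r := x / 2 ^+ k.
have r1 : 1 <= r by rewrite ler_pdivlMr// mul1r.
have r2 : r < 2 by rewrite ltr_pdivrMr// -exprS.
have s1 : k.+1%:R <= k%:R + r by rewrite -natr1; lra.
have s2 : k%:R + r < k.+2%:R by rewrite -[k.+2%:R]natr1 -[k.+1%:R]natr1; lra.
exists (k%:R + r); first by rewrite addr_ge0 ?ler0n//; lra.
rewrite (depth_linear s1 s2) -[k.+1%:R]natr1.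
have -> : k%:R + r - (k%:R + 1) + 1 = r by ring.
by rewrite /r mulrC divfK// gt_eqF.
Qed.

Lemma truncn_depth s n : 0 <= s -> depth s < 2 ^+ n -> (Num.truncn s <= n)%N.
Proof.
move=> s0; have /andP[k1 k2] := truncn_itv s0.
rewrite (depth_linear k1 k2) leqNgt; case: (Num.truncn s) k1 k2 => [//|k] k1 k2 d.
apply/negP; rewrite ltnS => nk; move: d; apply/negP; rewrite -leNgt.
rewrite -[leLHS]mulr1; apply: ler_pM => //; last by lra.
by rewrite ler_weXn2l// ler1n.
Qed.

Lemma depth_inj s s' : 0 <= s -> 0 <= s' -> depth s = depth s' -> s = s'.
Proof.
move=> s0 s0' e; have /andP[k1 k2] := truncn_itv s0; have /andP[j1 j2] := truncn_itv s0'.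
have /andP[_ d1] := depth_bound s0; have /andP[_ d2] := depth_bound s0'.
have kj : Num.truncn s = Num.truncn s'.
  by apply/eqP; rewrite eqn_leq !truncn_depth// ?e// -e.
move: e; rewrite kj in k1 k2; rewrite (depth_linear k1 k2) (depth_linear j1 j2).
case: (Num.truncn s') => [//|k] e.
have /mulfI/(_ _ _ e) : 2 ^+ k != 0 :> R by rewrite gt_eqF.
by lra.
Qed.

Lemma Psi_ge y s n : 0 <= s -> (Num.truncn s <= n)%N ->
  Psi phi H (y, s) n = phi y (depth s / 2 ^+ n).
Proof.
move=> s0 kn; rewrite /Psi /depth; case: ltP => //= s1.
rewrite ltnNge kn /=; congr (phi _ _).
have -> : 2 ^+ n = 2 ^+ Num.truncn s * 2 ^+ (n - Num.truncn s) :> R by rewrite -exprD subnKC.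
by field; rewrite !gt_eqF.
Qed.

Lemma Psi_Dhat y s : 0 <= s -> Dhat H (Psi phi H (y, s)).
Proof.
move=> s0; have /andP[d0 d1] := depth_bound s0.
have lev n : (Num.truncn s <= n)%N -> 0 <= depth s / 2 ^+ n <= 1.
  move=> kn; rewrite divr_ge0 ?(ltW (pow2_gt0 _))//= ler_pdivrMr// mul1r.
  by rewrite (le_trans (ltW d1))// ler_weXn2l// ler1n.
have low n : (n < Num.truncn s)%N -> Psi phi H (y, s) n =
    iter (Num.truncn s - n) H (phi y (depth s / 2 ^+ Num.truncn s)).
  move=> nk; have s1 : 1 <= s.
    rewrite leNgt; apply/negP => s1; by rewrite truncn_lt1 in nk.
  rewrite /Psi /depth ltNge s1 /= nk mulfK// gt_eqF//.
move=> n; split.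
  have [kn|nk] := leqP (Num.truncn s) n.
    by rewrite Psi_ge//; apply: Disk_phi => //; exact: lev.
  by rewrite low//; apply: iter_H_Disk; apply: Disk_phi => //; exact: lev.
have [kn|nk] := leqP (Num.truncn s) n.
  rewrite !Psi_ge//; last exact: leqW.
  by rewrite exprSr invfM mulrA H_half// lev.
rewrite (low n nk) -(subnSK nk) iterS; congr (H _).
have [k1|k1] := ltnP n.+1 (Num.truncn s); first exact: low.
have e : n.+1 = Num.truncn s by apply/eqP; rewrite eqn_leq nk.
by rewrite Psi_ge// -e subnn.
Qed.

(** One formula covers both branches of [Psi]: a late coordinate is explicit, and the earlier ones
    are its forward images. With [M] fixed, it is continuous in the data. *)
Lemma Psi_le y s M n : 0 <= s -> (Num.truncn s <= M)%N -> (n <= M)%N ->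
  Psi phi H (y, s) n = iter (M - n) H (phi y (depth s / 2 ^+ M)).
Proof.
by move=> s0 sM nM; rewrite -(Psi_ge y s0 sM) -(Dhat_iter n (M - n) (Psi_Dhat y s0)) subnKC.
Qed.

Let depth_lt1 s n : 0 <= s -> (Num.truncn s <= n)%N -> 0 <= depth s / 2 ^+ n < 1.
Proof.
move=> s0 kn; have /andP[d0 d1] := depth_bound s0.
rewrite divr_ge0 ?(ltW (pow2_gt0 _))//= ltr_pdivrMr// mul1r.
by rewrite (lt_le_trans d1)// ler_weXn2l// ler1n.
Qed.

Lemma Psi_notin_Ihat y s : 0 <= s -> ~ Ihat phi H (Psi phi H (y, s)).
Proof.
move=> s0 [_ /(_ (Num.truncn s))[x [_]]]; rewrite Psi_ge// /Defs.iota => e.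
have h := depth_lt1 s0 (leqnn (Num.truncn s)).
have [|e1 _] := phi_eq hphi h _ e; first by rewrite ler01 lexx.
by move: h; rewrite e1 ltxx andbF.
Qed.

Lemma Psi_inj p q : Adom p -> Adom q -> Psi phi H p = Psi phi H q -> p = q.
Proof.
move: p q => [y s] [y' s'] [/= y2 s0] [/= y2' s0'] e.
pose n := maxn (Num.truncn s) (Num.truncn s').
have := congr1 (fun z : seqT => z n) e; rewrite /= !Psi_ge ?leq_maxl ?leq_maxr// => en.
have h := depth_lt1 s0 (leq_maxl _ _ : (_ <= n)%N).
have /andP[h0' h1'] := depth_lt1 s0' (leq_maxr _ _ : (_ <= n)%N).
have h' : 0 <= depth s' / 2 ^+ n <= 1 by rewrite h0' ltW.
have [_ [_ [_ [inj _]]]] := hphi.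
have /andP[h0 h1] := h; have h'' : 0 <= depth s / 2 ^+ n <= 1 by rewrite h0 ltW.
have [[-> ed]|[ed _]] := (inj _ _ _ _ y2 y2' h'' h').1 en; last by rewrite ed ltxx in h1.
congr (_, _); apply: depth_inj => //.
by apply: (mulIf _ ed); rewrite invr_eq0 gt_eqF.
Qed.

(** On a slab [truncn] is constant and [depth] is affine. The slabs partition the parameter domain
    into measurable pieces. *)
Definition Aslab (k : nat) : set pt := [set p | [/\ 0 <= p.1 < 2 * pi, k%:R <= p.2 & p.2 < k.+1%:R]].

Lemma continuous_Psi_slab k : {within Aslab k, continuous (Psi phi H : pt -> seqT)}.
Proof.
apply: within_continuous_seq => n; pose M := maxn k n.
pose lin (s : R) := if k is k'.+1 then 2 ^+ k' * (s - k%:R + 1) else s.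
have clin : continuous lin.
  rewrite /lin; case: (k) => [|k'] s; first exact: cvg_id.
  apply: cvgM; first exact: cvg_cst.
  by apply: cvgD; [apply: cvgB; [exact: cvg_id|exact: cvg_cst]|exact: cvg_cst].
have sk (r : R) : k%:R <= r -> r < k.+1%:R -> 0 <= r /\ Num.truncn r = k.
  move=> ks sk; have s0 : 0 <= r by apply: le_trans ks; rewrite ler0n.
  by split => //; apply/eqP; rewrite truncn_eq// ks.
pose q (p : pt) : pt := (p.1, lin p.2 / 2 ^+ M).
have cq : {within Aslab k, continuous q}.
  apply: within_continuous_pair; apply: continuous_subspaceT => p; first exact: cvg_fst.
  apply: cvgM; last exact: cvg_cst.
  by apply: (cvg_comp _ _ cvg_snd); exact: clin.
have [_ [_ [cphi _]]] := hphi.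
have qs p : Aslab k p -> 0 <= (q p).2 < 1.
  move=> [_ k1 k2]; have [s0 tk] := sk _ k1 k2.
  by rewrite /q /lin /= -(depth_linear k1 k2) depth_lt1// tk leq_maxl.
have c1 : {within Aslab k, continuous (fun p => phi (q p).1 (q p).2)}.
  apply: (continuous_within_comp cq _ cphi) => p /qs /andP[q0 q1].
  by apply/andP; split => //; exact: ltW.
have c2 : {within Aslab k, continuous (fun p => iter (M - n) H (phi (q p).1 (q p).2))}.
  apply: (continuous_within_comp c1 _ (@continuous_iter_H (M - n)%N)) => p /qs /andP[q0 q1].
  by apply: Disk_phi => //; rewrite q0 ltW.
apply: subspace_eq_continuous c2 => -[y s]; rewrite inE => -[/= _ k1 k2].
have [s0 tk] := sk _ k1 k2.
by rewrite /from_subspace (@Psi_le y s M n)// ?tk ?leq_maxl ?leq_maxr// (depth_linear k1 k2).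
Qed.

(** The inverse of the chart given by coordinate [N]: earlier coordinates are forward images of [w],
    later ones are found by halving its height. *)
Definition thread (N : nat) (w : pt) : seqT := fun n =>
  if (n < N)%N then iter (N - n) H w else phi (cyl phi w).1 ((cyl phi w).2 / 2 ^+ (n - N)).

Lemma thread_diag N w : Disk w -> thread N w N = w.
Proof. by move=> Dw; rewrite /thread ltnn subnn expr0 divr1; case: (cylP hphi Dw). Qed.

Lemma thread_Dhat N w : Disk w -> Dhat H (thread N w).
Proof.
move=> Dw; have [_ /andP[l0 l1] ew] := cylP hphi Dw.
have lev k : 0 <= (cyl phi w).2 / 2 ^+ k <= 1.
  rewrite divr_ge0 ?(ltW (pow2_gt0 _))//= ler_pdivrMr// mul1r (le_trans l1)//.
  by rewrite exprn_ege1// ler1n.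
move=> n; split.
  rewrite /thread; case: ifP => _; first exact: iter_H_Disk.
  by apply: Disk_phi => //; exact: lev.
rewrite /thread; have [nN|Nn] := ltnP n N.
  have [nN'|Nn'] := ltnP n.+1 N; first by rewrite -iterS subnSK.
  have e : n.+1 = N by apply/eqP; rewrite eqn_leq nN.
  by rewrite -e subnn expr0 divr1 ew subSnn.
rewrite ifF; last by apply/negbTE; rewrite -leqNgt leqW.
by rewrite subSn// exprSr invfM mulrA H_half// lev.
Qed.

Lemma threadP N z : Dhat H z -> level phi (z N) < 1 -> thread N (z N) = z.
Proof.
move=> Dz l1; have DzN := (Dz N).1; have [_ /andP[l0 _] e] := cylP hphi DzN.
apply/funext => n; rewrite /thread; case: ltnP => nN.
  by rewrite -[RHS](Dhat_iter n (N - n) Dz) subnKC// ltnW.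
rewrite -{2}(subnKC nN); apply/esym/Dhat_lift => //.
by rewrite l0.
Qed.

(** The angle selected by [cyl] may jump, but below level 1 the whole generating line through [w] is
    determined by [w], so the points obtained by halving the height depend continuously on [w]. The
    bound 1/2 is one choice below 1. *)
Lemma continuous_thread N : {within [set w | Disk w /\ level phi w <= 1 / 2], continuous (thread N)}.
Proof.
apply: within_continuous_seq => n; have [nN|nN] := ltnP n N.
  have -> : (fun w => thread N w n : pt) = iter (N - n) H by apply/funext => w; rewrite /thread nN.
  have sub : [set w | Disk w /\ level phi w <= 1 / 2] `<=` @Disk R by move=> w [].
  exact: (continuous_subspaceW sub (@continuous_iter_H (N - n)%N)).
have -> : (fun w => thread N w n : pt) = fun w => phi (cyl phi w).1 ((cyl phi w).2 / 2 ^+ (n - N)).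
  by apply/funext => w; rewrite /thread ltnNge nN.
have cq : {within strip (1 / 2), continuous (fun p : pt => (p.1, p.2 / 2 ^+ (n - N)))}.
  apply: within_continuous_pair; apply: continuous_subspaceT => p; first exact: cvg_fst.
  by apply: cvgM; [exact: cvg_snd|exact: cvg_cst].
have [_ [_ [cphi _]]] := hphi.
have c1 : {within strip (1 / 2), continuous (fun p : pt => phi p.1 (p.2 / 2 ^+ (n - N)))}.
  apply: (continuous_within_comp cq _ cphi) => -[y s] [_ /=]; rewrite in_itv /= => /andP[s0 s1].
  rewrite divr_ge0 ?(ltW (pow2_gt0 _))//= ler_pdivrMr// mul1r (le_trans s1)//.
  by rewrite (@le_trans _ _ 1)//; [lra|rewrite exprn_ege1// ler1n].
apply: (@level_le_continuous _ _ hphi _ _ _ _ _ c1); first by apply/andP; split; lra.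
move=> y s /andP[s0 s1] /=.
have s01 : 0 <= s <= 1 by apply/andP; split; lra.
have [_ _ e] := cylP hphi (Disk_phi hphi y s01).
have := level_phi hphi y s01; rewrite /level => l; rewrite l in e *.
have s1' : 0 <= s < 1 by apply/andP; split; lra.
by have [_ ->] := phi_eq hphi s1' s01 e.
Qed.

(** Near [z] the projection to coordinate [N] is a chart with inverse [thread N], because a
    coordinate of level below 1 determines the whole sequence. *)
Lemma low_interior z N : Dhat H z -> 0 < level phi (z N) < 1 / 2 -> mfd_interior (Dhat H) z.
Proof.
move=> Dz /andP[l0 l1].
have [V [oV VE]] : exists V : set pt, open V /\
    V = [set w | Disk w /\ 0 < level phi w < 1 / 2].
  have [W oW WE] : exists2 W : set pt, open W &
      W `&` @Disk R = (level phi @^-1` `]-oo, 1 / 2[) `&` @Disk R.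
    apply/open_subspaceP; have /continuousP := continuous_level hphi; apply.
    exact: interval_open.
  (* The set [W] describes the sublevel set only relative to the disk; intersecting it with the open
     disk gives a set open in the plane and removes level 0. *)
  pose B : set pt := [set w | w.1 ^+ 2 + w.2 ^+ 2 < 4].
  have oB : open B.
    have -> : B = (fun w : pt => w.1 ^+ 2 + w.2 ^+ 2) @^-1` `]-oo, 4[.
      by apply/seteqP; split => w /=; rewrite in_itv.
    apply: open_comp; last exact: interval_open.
    move=> w _; rewrite /continuous_at; apply: cvgD.
      by apply: cvgM; exact: cvg_fst.
    by apply: cvgM; exact: cvg_snd.
  exists (B `&` W); split; first exact: openI.
  apply/seteqP; split => w /=.
    move=> [Bw Ww]; have Dw : Disk w by rewrite /Disk /= ltW.
    have : (W `&` @Disk R) w by [].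
    rewrite WE => -[/=]; rewrite in_itv /= => lw _.
    have /andP[lw0 _] := level_bound hphi Dw; split => //.
    rewrite lw andbT lt_neqAle lw0 andbT; apply/eqP => lw0'.
    have [y ey] := phi_level hphi Dw; have [phi0 _] := hphi.
    move: Bw; rewrite /B ey -lw0' phi0 /= => Bw.
    have := cos2Dsin2 y; nra.
  move=> [Dw /andP[lw0 lw1]]; split; first exact: (level_pos_lt hphi).
  have : ((level phi @^-1` `]-oo, 1 / 2[) `&` @Disk R) w by split => //=; rewrite in_itv.
  by rewrite -WE => -[].
exists ((fun z : seqT => z N : pt) @^-1` V), V, (fun z => z N), (thread N).
have oO : open ((fun z : seqT => z N : pt) @^-1` V).
  by apply: open_comp => // w _; exact: continuous_coord.
split => //; split; first by rewrite VE /=; split; [exact: (Dz N).1|rewrite l0].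
split => //; split.
  move=> w [Vw Dw]; split => //; apply: threadP => //.
  by move: Vw; rewrite VE /= => -[_ /andP[_ h]]; lra.
split.
  move=> w Vw; have Dw : Disk w by move: Vw; rewrite VE => -[].
  by split; [split; [rewrite /= thread_diag|exact: thread_Dhat]|exact: thread_diag].
split; first by apply: continuous_subspaceT; exact: continuous_coord.
apply: continuous_subspaceW (@continuous_thread N) => w.
by rewrite VE => -[Dw /andP[_ /ltW]].
Qed.

Lemma Psi_interior y s : 0 < s -> mfd_interior (Dhat H) (Psi phi H (y, s)).
Proof.
(* From index [truncn s] on the level is below 1; one more halving brings it below 1/2. *)
move=> s0; apply: (@low_interior _ (Num.truncn s).+1); first exact/Psi_Dhat/ltW.
have /andP[d0 d1] := depth_bound (ltW s0).
rewrite Psi_ge ?leqnSn ?(ltW s0)// level_phi//; last first.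
  by have /andP[-> /ltW] := depth_lt1 (ltW s0) (leqnSn (Num.truncn s)).
rewrite divr_gt0 ?depth_gt0//= ltr_pdivrMr// exprS; lra.
Qed.

(** A basic neighbourhood constrains only the coordinates before some [N], which are forward images
    of [z N]. Lowering the level of [z N] slightly, to a value [r < 1], changes them little, and
    [r * 2 ^ N] is the depth of a parameter [s]. *)
Lemma Psi_dense (O : set seqT) z : open O -> O z -> Dhat H z ->
  exists2 p, Adom p & O (Psi phi H p).
Proof.
move=> oO Oz Dz.
have [N [e [e0 He]]] := nbhs_box (open_nbhs_nbhs (conj oO Oz)).
have DzN := (Dz N).1; have [y ey] := phi_level hphi DzN.
have /andP[l0 l1] := level_bound hphi DzN; set l := level phi (z N) in ey l0 l1.
pose G (r : R) : seqT := fun i => iter (N - i) H (phi y r).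
have cG : {within `[0, 1], continuous G}.
  apply: within_continuous_seq => n.
  have cy : {within `[0, 1], continuous (fun r : R => (y, r))}.
    by apply: within_continuous_pair; apply: continuous_subspaceT => x; [exact: cvg_cst|exact: cvg_id].
  have [_ [_ [cphi _]]] := hphi.
  have c1 : {within `[0, 1], continuous (fun r : R => phi y r)}.
    by apply: (continuous_within_comp cy _ cphi) => r; rewrite /= in_itv.
  have Dr (r : R) : `[0, 1]%classic r -> Disk (phi y r) by rewrite /= in_itv; exact: Disk_phi.
  exact: (continuous_within_comp c1 Dr (@continuous_iter_H (N - n)%N)).
have Bl : nbhs (G l) [set w : seqT | forall i, (i < N)%N -> ball (z i) e (w i)].
  apply: open_nbhs_nbhs; split; first exact: open_box.
  move=> i iN; rewrite /G -ey -[X in ball _ _ (iter _ H (z X))](subnKC (ltnW iN)) Dhat_iter//.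
  exact: ballxx.
move: cG => /subspace_continuousP /(_ l) cG.
have l01 : `[0, 1]%classic l by rewrite /= in_itv /= l0.
have : within `[0, 1]%classic (nbhs l) (G @^-1` [set w : seqT | forall i, (i < N)%N -> ball (z i) e (w i)]) :=
  cG l01 _ Bl.
rewrite /within /= => /nbhs_ballP[d d0 Hd].
pose r := Num.max 0 (l - d / 2).
have r0 : 0 <= r by rewrite le_max lexx.
have rd : l - d / 2 <= r by rewrite le_max lexx orbT.
have d0' : 0 < d := d0.
have rl : r <= l by rewrite ge_max l0 /= gerBl divr_ge0// ltW.
have r1 : r < 1 by rewrite gt_max ltr01 /=; lra.
have [s s0 ds] : exists2 s, 0 <= s & depth s = r * 2 ^+ N.
  by apply: depth_surj; rewrite mulr_ge0// ltW.
have tN : (Num.truncn s <= N)%N by apply: truncn_depth => //; rewrite ds gtr_pMl.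
have [a [a2 ae _]] := phi_reduce hphi y.
exists (a, s) => //; apply: He => i iN.
rewrite (@Psi_le a s N i)// ?(ltnW iN)// ds mulfK ?gt_eqF// -ae.
apply: (Hd r) => //; last by rewrite in_itv /= r0 ltW.
by rewrite /ball /= ltr_norml; apply/andP; split; lra.
Qed.

End Unwrapping.

(** * Regularity as a countable condition *)

Section Cones.
Context {R : realType}.
Local Notation pt := (R * R)%type.
Local Notation coneT := ((rat * rat) * (rat * nat))%type.

(** The apex has rational position [r.1] and rational height [r.2.1], and the slope [r.2.2] is a
    natural number, which makes the family countable. Finite maxima of steep cones will approximate
    continuous functions. *)
Definition cone (r : coneT) (w : pt) : R :=
  ratr r.2.1 - r.2.2%:R * Num.max `|w.1 - ratr r.1.1| `|w.2 - ratr r.1.2|.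

Definition max_cone (B : nat) (s : seq coneT) (w : pt) : R :=
  foldr (fun r m => Num.max (cone r w) m) (- B%:R) s.

Lemma cone_le r w : cone r w <= ratr r.2.1.
Proof. by rewrite /cone gerBl mulr_ge0// le_max normr_ge0. Qed.

Lemma max_cone_le B s w u : - B%:R <= u -> (forall r, r \in s -> cone r w <= u) ->
  max_cone B s w <= u.
Proof.
move=> Bu; elim: s => [//|r s IH] H; rewrite /= ge_max H ?mem_head//=.
by apply: IH => r' r's; apply: H; rewrite inE r's orbT.
Qed.

Lemma le_max_cone B s w r : r \in s -> cone r w <= max_cone B s w.
Proof.
elim: s => [//|r' s IH]; rewrite inE /= le_max => /orP[/eqP->|/IH ->]; rewrite ?lexx// orbT//.
Qed.

Lemma max_cone_ge B s w : - B%:R <= max_cone B s w.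
Proof. by elim: s => [|r s IH] //=; rewrite le_max IH orbT. Qed.

Lemma max_cone_bounded B s : exists C : R, forall w, `|max_cone B s w| <= C.
Proof.
have [U HU] : exists U : R, forall r, r \in s -> ratr r.2.1 <= U.
  elim: s => [|r s [U HU]]; first by exists 0.
  exists (Num.max (ratr r.2.1) U) => r'; rewrite inE le_max => /orP[/eqP->|/HU->]; rewrite ?lexx ?orbT//.
exists (Num.max B%:R U) => w; rewrite ler_norml; apply/andP; split.
  by apply: le_trans (max_cone_ge B s w); rewrite lerN2 le_max lexx.
apply: max_cone_le => [|r rs]; first by rewrite (@le_trans _ _ 0) ?oppr_le0// le_max ler0n.
by rewrite (le_trans (cone_le r w))// le_max HU ?orbT.
Qed.

Let continuous_cone r : continuous (cone r).
Proof.
move=> w; apply: cvgB; first exact: cvg_cst.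
apply: cvgM; first exact: cvg_cst.
have c1 : {for w, continuous (fun w : pt => `|w.1 - ratr r.1.1|)}.
  by apply: cvg_norm; apply: cvgB; [exact: cvg_fst|exact: cvg_cst].
have c2 : {for w, continuous (fun w : pt => `|w.2 - ratr r.1.2|)}.
  by apply: cvg_norm; apply: cvgB; [exact: cvg_snd|exact: cvg_cst].
exact: (continuous_max c1 c2).
Qed.

Lemma continuous_max_cone B s : continuous (max_cone B s).
Proof.
elim: s => [|r s IH] w; first exact: cvg_cst.
by apply: (continuous_max (@continuous_cone r w) (IH w)).
Qed.

Lemma measurable_max_cone B s : measurable_fun setT (max_cone B s).
Proof.
elim: s => [|r s IH]; first exact: measurable_cst.
apply: measurable_maxr => //; apply: measurable_funB => //; apply: measurable_funM => //.
by apply: measurable_maxr; apply: measurableT_comp => //; apply: measurable_funB.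
Qed.

End Cones.

(* Stated without a base point, which the library's [compact_cover] requires. *)
Lemma compact_seq_cover (T : topologicalType) (A : set T) (W : T -> set T) :
  compact A -> (forall x, A x -> open (W x) /\ W x x) ->
  exists s : seq T, (forall x, x \in s -> A x) /\
    forall x, A x -> exists2 y, y \in s & W y x.
Proof.
rewrite compact_near_coveringP => cA HW.
pose F : set_system (seq T) := [set U : set (seq T) | exists s0 : seq T, (forall x, x \in s0 -> A x) /\
  forall s : seq T, {subset s0 <= s} -> (forall x, x \in s -> A x) -> U s].
have FF : Filter F.
  split; first by exists [::].
    move=> U V [s1 [A1 H1]] [s2 [A2 H2]]; exists (s1 ++ s2); split.
      by move=> x; rewrite mem_cat => /orP[/A1|/A2].
    move=> s sub As; split; [apply: H1 => // x xs|apply: H2 => // x xs];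
      by apply: sub; rewrite mem_cat xs ?orbT.
  by move=> U V UV [s1 [A1 H1]]; exists s1; split => // s sub As; apply: UV; exact: H1.
have [|s0 [As0 H0]] := cA (seq T) F (fun s x => exists2 y, y \in s & W y x) FF.
  move=> x Ax; have [oW Wx] := HW x Ax.
  exists (W x, [set s : seq T | x \in s]).
    split; first exact: open_nbhs_nbhs.
    exists [:: x]; split; first by move=> y; rewrite inE => /eqP ->.
    by move=> s sub _; apply: sub; rewrite inE.
  by move=> [x' s] [/= Wx' xs]; exists x.
by exists s0; split => // x Ax; exact: (H0 s0 (fun y h => h) As0 x Ax).
Qed.

(** * Uniform approximation of continuous functions on the inverse limit *)

Section Approximation.
Context {R : realType}.
Local Notation pt := (R * R)%type.
Local Notation seqT := {ptws nat -> (R * R)%type}.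
Variables (phi : R -> R -> pt) (Ups : pt -> pt) (fb : R -> pt -> pt) (t : R).
Hypotheses (hphi : cyl_param phi) (hUps : is_Upsilon phi Ups)
  (hfb : unwrapping phi Ups fb) (ht : Jint t).
Local Notation H := (Ups \o fb t).

(* The continuous function depends, up to [e], on a single coordinate only. *)
Let single_coord (alpha : seqT -> R) (e : R) : {within Dhat H, continuous alpha} -> 0 < e ->
  exists N (M : R), (forall z, Dhat H z -> `|alpha z| <= M) /\
    forall x, Dhat H x -> exists2 d, 0 < d & forall z, Dhat H z -> ball (x N) d (z N) ->
      `|alpha z - alpha x| < 2 * e.
Proof.
move=> /subspace_continuousP ca e0.
have boxes x : exists p : nat * R, Dhat H x -> 0 < p.2 /\ forall z, Dhat H z ->
    (forall i, (i < p.1)%N -> ball (x i) p.2 (z i)) -> `|alpha z - alpha x| < e.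
  have [Dx|nDx] := pselect (Dhat H x); last by exists (0%N, 0).
  move: (ca x Dx) => /cvgr_dist_lt /(_ e e0); rewrite near_withinE => /nbhs_box[N [d [d0 Hd]]].
  by exists (N, d) => _; split => // z Dz /Hd /(_ Dz); rewrite distrC.
have [P HP] := choice boxes.
have [|s [sD scov]] := @compact_seq_cover _ (Dhat H)
    (fun x => [set w : seqT | forall i, (i < (P x).1)%N -> ball (x i) (P x).2 (w i)])
    (compact_Dhat hphi hUps hfb ht).
  move=> x Dx; split; first exact: open_box.
  by move=> i _; apply: ballxx; case: (HP x Dx).
pose N := \max_(x <- s) (P x).1.
have NP x : x \in s -> ((P x).1 <= N)%N by move=> xs; exact: leq_bigmax_seq.
exists N, (\sum_(x <- s) `|alpha x| + e); split.
  move=> z Dz; have [x xs Wx] := scov z Dz.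
  have [_ /(_ z Dz Wx) h] := HP x (sD x xs).
  have : `|alpha x| <= \sum_(x <- s) `|alpha x|.
    by rewrite (big_rem x)//= lerDl sumr_ge0.
  have := ler_normD (alpha z - alpha x) (alpha x); rewrite subrK; lra.
move=> x Dx; have [y ys Wy] := scov x Dx.
have [_ Hy] := HP y (sD y ys).
pose K (w : pt) : seqT := fun i => iter (N - i) H w.
have cK : {within @Disk R, continuous K}.
  by apply: within_continuous_seq => i; exact: (continuous_iter_H hphi hUps hfb ht).
have Kz z i : Dhat H z -> (i <= N)%N -> K (z N) i = z i.
  by move=> Dz iN; rewrite -[RHS](Dhat_iter i (N - i) Dz) subnKC.
pose W := [set w : seqT | forall i, (i < (P y).1)%N -> ball (y i) (P y).2 (w i)].
have WK : nbhs (K (x N)) W.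
  apply: open_nbhs_nbhs; split; first exact: open_box.
  move=> i iP; rewrite Kz//; first exact: Wy.
  by rewrite ltnW// (leq_trans iP)// NP.
move: cK => /subspace_continuousP /(_ (x N) (Dx N).1) cK.
have : within (@Disk R) (nbhs (x N)) (K @^-1` W) := cK _ WK.
rewrite /within /= => /nbhs_ballP[d d0 Hd].
exists d => // z Dz zd.
have Wz : W z.
  have := Hd _ zd (Dz N).1; move=> KW i iP; have := KW i iP; rewrite Kz//.
  by rewrite ltnW// (leq_trans iP)// NP.
have := Hy z Dz Wz; have := Hy x Dx Wy.
have := ler_distD (alpha y) (alpha z) (alpha x); rewrite (distrC (alpha y)); lra.
Qed.

(** At each point a cone is chosen that stays below [alpha + e] everywhere and above [alpha - e]
    nearby; compactness selects finitely many of them. The error [e] consists of [e / 2] from the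
    dependence on other coordinates, [e / 4] from the rational height and [e / 4] from the slope. *)
Lemma max_cone_approx (alpha : seqT -> R) (e : R) : {within Dhat H, continuous alpha} -> 0 < e ->
  exists N B s, forall z, Dhat H z -> `|alpha z - max_cone B s (z N)| <= e.
Proof.
move=> ca e0; pose e4 := e / 4.
have e4e : e = 4 * e4 by rewrite /e4; field.
have e40 : 0 < e4 by rewrite divr_gt0.
have [N [M [HM HN]]] := single_coord ca e40.
pose B := (Num.truncn `|M|).+1.
have MB : M < B%:R by apply: le_lt_trans (ler_norm M) _; exact: truncnS_gt.
have aB z : Dhat H z -> - B%:R <= alpha z <= B%:R.
  by move=> /HM; rewrite ler_norml => /andP[h1 h2]; apply/andP; split; lra.
have B0 : 0 < B%:R :> R by rewrite ltr0n.
have pick x : exists p : ((rat * rat) * (rat * nat)) * R, Dhat H x -> [/\ 0 < p.2,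
    forall z, Dhat H z -> cone p.1 (z N) <= alpha z + e &
    forall z, Dhat H z -> ball (x N) p.2 (z N) -> alpha z - e <= cone p.1 (z N)].
  have [Dx|nDx] := pselect (Dhat H x); last by exists (((0, 0), (0, 0%N)), 0).
  have [d d0 Hd] := HN x Dx.
  (* So steep that the cone has dropped by more than [2 * B] at distance [d / 2] from its centre,
     hence lies below [- B] there. *)
  pose L := (Num.truncn (4 * B%:R / d)).+1.
  have LB : 4 * B%:R < L%:R * d by rewrite -ltr_pdivrMr//; exact: truncnS_gt.
  have L0 : 0 < L%:R :> R by rewrite ltr0n.
  (* Points within [h] of [x N] are within [2 * h] of the rational centre, where the cone has lost
     at most [e / 4]. *)
  pose h := Num.min (d / 2) (e4 / (2 * L%:R)).
  have h0 : 0 < h by rewrite lt_min !divr_gt0 ?mulr_gt0.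
  have hd : h <= d / 2 by rewrite ge_min lexx.
  have hL : L%:R * (2 * h) <= e4.
    have : h <= e4 / (2 * L%:R) by rewrite ge_min lexx orbT.
    by rewrite ler_pdivlMr ?mulr_gt0//; lra.
  have rq (u : R) : exists q : rat, `|u - ratr q| < h.
    have [|q qi] := @rat_in_itvoo R (u - h) (u + h); first lra.
    by exists q; move: qi; rewrite in_itv /= ltr_norml => /andP[? ?]; apply/andP; split; lra.
  have [q1 Hq1] := rq (x N).1; have [q2 Hq2] := rq (x N).2.
  have [|c] := @rat_in_itvoo R (alpha x - e4) (alpha x); first lra.
  rewrite in_itv /= => /andP[c1 c2].
  exists (((q1, q2), (c, L)), h) => _; split => //= z Dz.
    have [small|big] := ltP (Num.max `|(z N).1 - ratr q1| `|(z N).2 - ratr q2|) (d / 2).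
      apply: (le_trans (cone_le _ _)) => /=.
      have bd : ball (x N) d (z N).
        move: small; rewrite gt_max => /andP[s1 s2]; split; rewrite /ball /=.
          have := ler_distD (ratr q1) (x N).1 (z N).1; rewrite (distrC (ratr q1)); lra.
        have := ler_distD (ratr q2) (x N).2 (z N).2; rewrite (distrC (ratr q2)); lra.
      by have := Hd z Dz bd; rewrite ltr_norml => /andP[h1 h2]; lra.
    rewrite /cone /=; have /andP[aBx1 aBx2] := aB x Dx; have /andP[aBz1 aBz2] := aB z Dz.
    move: big; set D := Num.max _ _ => big.
    have : L%:R * (d / 2) <= L%:R * D by rewrite ler_pM2l.
    lra.
  move=> [b1 b2]; rewrite /ball /= in b1 b2.
  have bd : ball (x N) d (z N) by split; rewrite /ball /=; lra.
  have := Hd z Dz bd; rewrite ltr_norml => /andP[h1 h2].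
  rewrite /cone /=; set D := Num.max _ _.
  have : D <= 2 * h.
    rewrite ge_max; apply/andP; split.
      have := ler_distD (x N).1 (z N).1 (ratr q1); rewrite (distrC (z N).1 (x N).1); lra.
    have := ler_distD (x N).2 (z N).2 (ratr q2); rewrite (distrC (z N).2 (x N).2); lra.
  rewrite -(ler_pM2l L0); lra.
have [p Hp] := choice pick.
have [|s [sD scov]] := @compact_seq_cover _ (Dhat H)
    (fun x => (fun z : seqT => z N : pt) @^-1` ball (x N) (p x).2)
    (compact_Dhat hphi hUps hfb ht).
  move=> x Dx; split.
    by apply: open_comp; [move=> w _; exact: continuous_coord|exact: ball_open].
  by apply: ballxx; case: (Hp x Dx).
exists N, B, [seq (p x).1 | x <- s] => z Dz.
have [y ys Wy] := scov z Dz; have [_ _ /(_ z Dz Wy) low] := Hp y (sD y ys).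
have up : max_cone B [seq (p x).1 | x <- s] (z N) <= alpha z + e.
  apply: max_cone_le => [|r /mapP[x xs ->]]; first by have /andP[h1 _] := aB z Dz; lra.
  by have [_ /(_ z Dz)] := Hp x (sD x xs).
have : alpha z - e <= max_cone B [seq (p x).1 | x <- s] (z N).
  by apply: le_trans low _; apply: le_max_cone; apply/mapP; exists y.
by rewrite ler_norml => h; apply/andP; split; lra.
Qed.

End Approximation.

Lemma cesaro_shift (R : realType) (u v : nat -> R) (N : nat) (c : R) :
  (forall n, u (n + N)%N = v n) ->
  (fun n : nat => n%:R^-1 * \sum_(i < n) v i) @ \oo --> c ->
  (fun n : nat => n%:R^-1 * \sum_(i < n) u i) @ \oo --> c.
Proof.
move=> uv cv; pose A := \sum_(i < N) u i.
have L : 0 * A + (c - 0 * N%:R * c) = c by rewrite !mul0r subr0 add0r.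
rewrite -L -(cvg_shiftn N).
have ci : (fun n : nat => (n + N)%:R^-1) @ \oo --> (0 : R).
  apply/cvgrPdist_le => e e0; near=> n.
  have ne : e^-1 < n%:R.
    apply: (@lt_trans _ _ (Num.truncn e^-1).+1%:R); first exact: truncnS_gt.
    by rewrite ltr_nat; near: n; exact: nbhs_infty_gt.
  have n0 : 0 < n%:R :> R by apply: lt_trans ne; rewrite invr_gt0.
  rewrite sub0r normrN ger0_norm ?invr_ge0// -[leRHS]invrK natrD.
  by rewrite lef_pV2 ?posrE ?invr_gt0 ?ltr_wpDr// (le_trans (ltW ne))// lerDl.
(* The factor [n / (n + N)] is written as [1 - N / (n + N)], so that only null sequences and the
   given averages remain. *)
have -> : (fun n : nat => (n + N)%:R^-1 * \sum_(i < n + N) u i) =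
    (fun n : nat => (n + N)%:R^-1 * A +
      (n%:R^-1 * \sum_(i < n) v i - (n + N)%:R^-1 * N%:R * (n%:R^-1 * \sum_(i < n) v i))).
  apply/funext => n; rewrite addnC big_split_ord /= -/A.
  under eq_bigr => i _ do rewrite addnC uv.
  case: n => [|n].
    by rewrite !big_ord0 !mulr0 subrr addr0 addr0.
  rewrite addnC mulrDr; congr (_ + _); rewrite natrD.
  have n0 : n.+1%:R != 0 :> R by rewrite pnatr_eq0.
  have nN0 : n.+1%:R + N%:R != 0 :> R by rewrite -natrD pnatr_eq0.
  move: (n.+1%:R) n0 nN0 (\sum_(i < n.+1) v i) => a n0 nN0 S.
  by field; rewrite nN0 n0.
apply: cvgD; first by apply: cvgM => //; exact: cvg_cst.
by apply: cvgB => //; apply: cvgM => //; apply: cvgM => //; exact: cvg_cst.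
Unshelve. all: by end_near. Qed.

(** * Countably many test functions decide regularity *)

Section Regular.
Context {R : realType}.
Local Notation pt := (R * R)%type.
Local Notation seqT := {ptws nat -> (R * R)%type}.
Local Notation testT := (nat * (nat * seq ((rat * rat) * (rat * nat))))%type.
Variables (phi : R -> R -> pt) (Ups : pt -> pt) (fb : R -> pt -> pt) (t : R).
Hypotheses (hphi : cyl_param phi) (hUps : is_Upsilon phi Ups)
  (hfb : unwrapping phi Ups fb) (ht : Jint t).
Local Notation H := (Ups \o fb t).
Variables (muhat : probability (Bor R) R).
Hypothesis (muhatD : muhat (Dhat H : set (Bor R)) = 1%E).

Definition test (i : testT) (z : seqT) : R := max_cone i.2.1 i.2.2 (z i.1).

Lemma Borel_closed (C : set seqT) : closed C -> Borel C.
Proof.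
move=> cC; rewrite -(setCK C).
have : measurable (~` C : set (Bor R)) by apply: sub_sigma_algebra; rewrite openC.
by move/measurableC.
Qed.

Let mDhat : measurable (Dhat H : set (Bor R)).
Proof. exact: Borel_closed (closed_Dhat hphi hUps hfb ht). Qed.

Let measurable_continuous (alpha : seqT -> R) : {within Dhat H, continuous alpha} ->
  measurable_fun (Dhat H : set (Bor R)) (alpha : Bor R -> R).
Proof.
move=> ca mD; apply: (measurability _ (RGenCInfty.measurableE R)) => //.
move=> _ [_ [x ->] <-]; apply: Borel_closed.
apply: (closed_within_preimage _ ca); first exact: (closed_Dhat hphi hUps hfb ht).
exact: interval_closed.
Qed.

Lemma continuous_test i : {within Dhat H, continuous (test i)}.
Proof.
apply: continuous_subspaceT => z.
exact: (continuous_comp (@continuous_coord R i.1 z) (@continuous_max_cone R _ _ _)).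
Qed.

Let average (alpha : seqT -> R) (z : seqT) (n : nat) : R :=
  n%:R^-1 * \sum_(i < n) alpha (iter i (Hhat H) z).

Let continuous_average (alpha : seqT -> R) n : {within Dhat H, continuous alpha} ->
  {within Dhat H, continuous (fun z => average alpha z n)}.
Proof.
move=> ca; have ci k : {within Dhat H, continuous (fun z => alpha (iter k (Hhat H) z))}.
  exact: (continuous_within_comp (@continuous_iter_Hhat R phi Ups fb t hphi hUps hfb ht k)
    (fun z => @iter_Hhat_Dhat R phi Ups fb t hphi hUps hfb ht k z) ca).
have cs : {within Dhat H, continuous (fun z => \sum_(i < n) alpha (iter i (Hhat H) z))}.
  elim: n => [|n IH].
    have -> : (fun z : seqT => \sum_(i < 0) alpha (iter i (Hhat H) z)) = (fun=> 0 : R).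
      by apply/funext => z; rewrite big_ord0.
    apply: continuous_subspaceT; exact: cst_continuous.
  have -> : (fun z => \sum_(i < n.+1) alpha (iter i (Hhat H) z)) =
      fun z => \sum_(i < n) alpha (iter i (Hhat H) z) + alpha (iter n (Hhat H) z).
    by apply/funext => z; rewrite big_ord_recr.
  move: IH (ci n) => /subspace_continuousP IH /subspace_continuousP cn.
  by apply/subspace_continuousP => z Dz; apply: cvgD; [exact: IH|exact: cn].
move: cs => /subspace_continuousP cs; apply/subspace_continuousP => z Dz.
by apply: cvgM; [exact: cvg_cst|exact: cs].
Qed.

Let integrable_bounded (alpha : seqT -> R) (C : R) : {within Dhat H, continuous alpha} ->
  (forall z, Dhat H z -> `|alpha z| <= C) ->
  muhat.-integrable (Dhat H : set (Bor R)) (EFin \o (alpha : Bor R -> R)).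
Proof.
move=> ca aC; apply: (@bounded_integrable _ _ _ muhat _ _ C mDhat) => //.
exact: measurable_continuous.
Qed.

Let Rintegral_close (alpha beta : seqT -> R) (C e : R) :
  {within Dhat H, continuous alpha} -> {within Dhat H, continuous beta} ->
  (forall z, Dhat H z -> `|beta z| <= C) ->
  (forall z, Dhat H z -> `|alpha z - beta z| <= e) ->
  `|\int[muhat]_(z in (Dhat H : set (Bor R))) alpha z -
    \int[muhat]_(z in (Dhat H : set (Bor R))) beta z| <= e.
Proof.
move=> ca cb bC abe.
have ib := integrable_bounded cb bC.
have ia : muhat.-integrable (Dhat H : set (Bor R)) (EFin \o (alpha : Bor R -> R)).
  apply: (@integrable_bounded _ (C + e) ca) => z Dz.
  by have := ler_normD (alpha z - beta z) (beta z); rewrite subrK; have := bC z Dz; have := abe z Dz; lra.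
rewrite -(RintegralB mDhat ia ib).
have iab : muhat.-integrable (Dhat H : set (Bor R)) (EFin \o (fun z : Bor R => alpha z - beta z)).
  by have := integrableB mDhat ia ib.
apply: le_trans (le_normr_Rintegral mDhat iab) _.
have -> : e = \int[muhat]_(z in (Dhat H : set (Bor R))) e.
  by rewrite /Rintegral integral_cst//= muhatD mule1.
apply: (le_Rintegral mDhat) => //.
- by have := integrable_abse iab; apply: eq_integrable.
- by apply: (@bounded_integrable _ _ _ muhat _ (cst e) `|e|) => //; exact: measurable_cst.
Qed.

Let test_bounded i : exists C : R, forall z, `|test i z| <= C.
Proof. by have [C HC] := @max_cone_bounded R i.2.1 i.2.2; exists C => z; exact: HC. Qed.

(** A uniform error on the inverse limit enters an orbit average and the integral with at most its
    own size, since [muhat] has mass one and orbits stay inside. So convergence for the countable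
    family is enough, within [3 * (e / 3)]. *)
Lemma regular_pointP z : Dhat H z ->
  regular_point (Dhat H) (Hhat H) muhat z <->
  forall i, (fun n : nat => average (test i) z n) @ \oo -->
    \int[muhat]_(z in (Dhat H : set (Bor R))) test i z.
Proof.
move=> Dz; split => [reg i|Ht alpha ca]; first exact/reg/continuous_test.
apply/cvgrPdist_le => e e0; have e3 : 0 < e / 3 by rewrite divr_gt0.
have [N [B [s Hs]]] := max_cone_approx hphi hUps hfb ht ca e3.
pose i : testT := (N, (B, s)).
have [C HC] := test_bounded i.
have ci := @continuous_test i.
have h1 := Rintegral_close ca ci (fun z _ => HC z) Hs.
have /cvgrPdist_le /(_ _ e3) := Ht i; apply: filterS => n h2.
have h3 : `|average (test i) z n - average alpha z n| <= e / 3.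
  rewrite /average -mulrBr -sumrB.
  case: n {h2} => [|n]; first by rewrite big_ord0 mulr0 normr0 ltW.
  rewrite normrM ger0_norm ?invr_ge0// ler_pdivrMl ?ltr0n//.
  apply: le_trans (ler_norm_sum _ _ _) _.
  rewrite (_ : n.+1%:R * (e / 3) = \sum_(j < n.+1) (e / 3)); last first.
    by rewrite sumr_const card_ord mulr_natl.
  apply: ler_sum => j _; rewrite distrC; apply: Hs.
  exact: (iter_Hhat_Dhat hphi hUps hfb ht).
rewrite -/(average alpha z n).
move: h1 h2 h3; set I1 := Rintegral _ _ _; set I2 := Rintegral _ _ _ => h1 h2 h3.
have := ler_distD I2 I1 (average alpha z n).
have := ler_distD (average (test i) z n) I2 (average alpha z n).
lra.
Qed.

Lemma Borel_regular :
  Borel [set z | Dhat H z /\ regular_point (Dhat H) (Hhat H) muhat z].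
Proof.
pose I i := \int[muhat]_(z in (Dhat H : set (Bor R))) test i z.
pose C i (e : R) n := Dhat H `&` (fun z => average (test i) z n) @^-1` [set x | `|I i - x| <= e].
have mC i e n : measurable (C i e n : set (Bor R)).
  apply: Borel_closed; apply: closed_within_preimage.
  - exact: (closed_Dhat hphi hUps hfb ht).
  - exact/continuous_average/continuous_test.
  - have -> : [set x | `|I i - x| <= e] = `[I i - e, I i + e]%classic.
      by apply/seteqP; split => x /=; rewrite in_itv /= ler_norml => h; apply/andP; split; lra.
    exact: interval_closed.
(* Tests are enumerated by their codes, and numbers that code no test contribute [setT]. Each
   convergence becomes a countable combination of closed sets [C]. *)
pose S (k : nat) : set (Bor R) := if unpickle k is Some i then
  \bigcap_j \bigcup_m \bigcap_n (if (m <= n)%N then C i j.+1%:R^-1 n else setT) else setT.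
suff -> : [set z | Dhat H z /\ regular_point (Dhat H) (Hhat H) muhat z] = Dhat H `&` \bigcap_k S k.
  apply: (@measurableI _ (Bor R)); first exact: mDhat.
  apply: bigcapT_measurable => k; rewrite /S; case: (unpickle k) => [i|]; last exact: measurableT.
  apply: bigcapT_measurable => j; apply: bigcupT_measurable => m; apply: bigcapT_measurable => n.
  by case: ifP => // _; exact: mC.
apply/seteqP; split => z /=.
  move=> [Dz /(regular_pointP Dz) Ht]; split => // k _; rewrite /S.
  case: (unpickle k) => [i|//] j _.
  have j0 : 0 < j.+1%:R^-1 :> R by rewrite invr_gt0.
  have /cvgrPdist_le /(_ _ j0) [m _ Hm] := Ht i.
  by exists m => // n _; case: ifP => // mn; split => //; exact: Hm.
move=> [Dz HS]; split => //; apply/(regular_pointP Dz) => i.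
apply/cvgrPdist_le => e e0.
have := HS (pickle i) Logic.I; rewrite /S pickleK => /(_ (Num.truncn e^-1) Logic.I)[m _ Hm].
exists m => // n /= mn; have := Hm n Logic.I; rewrite mn => -[_ /=] h; apply: le_trans h _.
rewrite -[leRHS]invrK lef_pV2 ?posrE ?invr_gt0//; exact/ltW/truncnS_gt.
Qed.

End Regular.

(** * The measures m and rho' *)

Section PlaneMeasure.
Context {R : realType}.
Local Notation pt := (R * R)%type.
Local Notation lam := (@lebesgue_measure R).

(** Measurability in the plane refers to the product sigma-algebra, and the countably many rational
    boxes link it to the topology. *)
Lemma measurable_open_plane (U : set pt) : open U -> measurable U.
Proof.
move=> oU.
pose box (r : rat * rat * (rat * rat)) : set pt :=
  `]ratr r.1.1, ratr r.1.2[ `*` `]ratr r.2.1, ratr r.2.2[.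
pose S (k : nat) : set pt := if unpickle k is Some r then
  (if `[< box r `<=` U >] then box r else set0) else set0.
have -> : U = \bigcup_k S k.
  apply/seteqP; split => p; last first.
    move=> [k _]; rewrite /S; case: (unpickle k) => [r|//].
    by case: asboolP => [sub|_ //]; exact: sub.
  move=> Up; have /nbhs_ballP[e e0 He] : nbhs p U by exact: open_nbhs_nbhs.
  have e0' : 0 < e := e0.
  have rq (u : R) : exists q : rat * rat, u - e < ratr q.1 < u /\ u < ratr q.2 < u + e.
    have [|a] := @rat_in_itvoo R (u - e) u; first by rewrite gtrBl.
    have [|b] := @rat_in_itvoo R u (u + e); first by rewrite ltrDl.
    by rewrite !in_itv /= => bu au; exists (a, b).
  have [a [a1 a2]] := rq p.1; have [b [b1 b2]] := rq p.2.
  exists (pickle (a, b)); first by [].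
  rewrite /S pickleK.
  have -> : `[< box (a, b) `<=` U >] = true.
    apply/asboolP => q [/=]; rewrite !in_itv /= => q1 q2; apply: He; split; rewrite /ball /= ltr_norml;
      apply/andP; split; lra.
  by split; rewrite /= in_itv /=; lra.
apply: bigcupT_measurable => k; rewrite /S; case: (unpickle k) => [r|]; last exact: measurable0.
case: ifP => _; last exact: measurable0.
by apply: measurableX; exact: measurable_itv.
Qed.

Let h (p : pt) : \bar R := ((1 + p.2 ^+ 2)^-1)%:E.

Let den_gt0 (s : R) : 0 < 1 + s ^+ 2.
Proof. by rewrite ltr_pwDl// sqr_ge0. Qed.

Let h_ge0 p : (0 <= h p)%E.
Proof. by rewrite lee_fin invr_ge0 ltW. Qed.

Let measurable_h D : measurable_fun D h.
Proof.
apply: measurable_funTS; apply/measurable_EFinP.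
apply: (@measurableT_comp _ _ _ _ _ _ (fun s : R => (1 + s ^+ 2)^-1)); last exact: measurable_snd.
apply: continuous_measurable_fun => s; apply: cvgV; first by rewrite gt_eqF.
by apply: cvgD; [exact: cvg_cst|apply: cvgM; exact: cvg_id].
Qed.

Let mAdom : measurable (@Adom R).
Proof.
have -> : @Adom R = (`[0, 2 * pi[ `*` `[0, +oo[)%classic.
  by apply/seteqP; split => p /=; rewrite !in_itv /= andbT.
by apply: measurableX; exact: measurable_itv.
Qed.

Let pi20 : 0 <= (pi ^+ 2)^-1 :> R. Proof. by rewrite invr_ge0 sqr_ge0. Qed.

(** The integral of a nonnegative function is a supremum over simple functions below it, so
    monotonicity holds for arbitrary sets. Null sets such as the manifold boundary can then be
    treated without proving them measurable. *)
Lemma m_A_subset (A B : set pt) : A `&` @Adom R `<=` B -> (m_A A <= m_A B)%E.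
Proof.
move=> AB; rewrite /m_A; apply: lee_wpmul2l => //.
rewrite !ge0_integralE; try by move=> p _; exact: h_ge0.
apply: ge_ereal_sup => _ /= [g Hg <-]; apply: ereal_sup_ubound.
exists g => // p; apply: le_trans (Hg p) _; rewrite /patch.
case: ifPn => [|_]; last by case: ifP => // _; exact: h_ge0.
by rewrite inE => -[Ap Dp]; rewrite mem_set//; split => //; exact: AB.
Qed.

Lemma m_A_ge0 (A : set pt) : (0 <= m_A A)%E.
Proof.
by apply: mule_ge0; [rewrite lee_fin|apply: integral_ge0 => p _; exact: h_ge0].
Qed.

Lemma m_A_eq (A B : set pt) : A `&` @Adom R = B `&` @Adom R -> m_A A = m_A B.
Proof. by rewrite /m_A => ->. Qed.

Let null_rect (A B : set R) (E : set pt) : measurable A -> measurable B ->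
  (lam A * lam B = 0)%E -> E `&` @Adom R `<=` A `*` B -> m_A E = 0%E.
Proof.
move=> mA mB AB0 EAB; apply/eqP; rewrite eq_le m_A_ge0 andbT.
apply: le_trans (m_A_subset EAB) _; rewrite /m_A.
have mAB : measurable (A `*` B) by exact: measurableX.
have AB2 : (lam \x lam)%E (A `*` B) = (lam A * lam B)%E by exact: product_measure1E.
have mABD : measurable (A `*` B `&` @Adom R) by exact: measurableI.
rewrite null_set_integral ?mule0//; first exact: measurable_h.
apply/eqP; rewrite -measure_le0 -AB0 -AB2.
by apply: le_measure; rewrite ?inE.
Qed.

Lemma m_A_singleton (E : set pt) p : E `&` @Adom R `<=` [set p] -> m_A E = 0%E.
Proof.
move=> Ep; apply: (@null_rect [set p.1] [set p.2]) => //.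
  by rewrite !lebesgue_measure_set1 mule0.
by move=> q /Ep ->.
Qed.

Lemma m_A_bottom (E : set pt) : E `&` @Adom R `<=` [set p | p.2 = 0] -> m_A E = 0%E.
Proof.
move=> E0; apply: (@null_rect setT [set 0]) => //.
  by rewrite lebesgue_measure_set1 mule0.
by move=> q /E0.
Qed.

Lemma m_A_rect_gt0 (C : set R) (a b : R) (E : set pt) : measurable C ->
  (0 < lam C)%E -> a < b -> C `*` `[a, b] `<=` E `&` @Adom R -> (0 < m_A E)%E.
Proof.
move=> mC C0 ab CE.
apply: (@lt_le_trans _ _ (m_A (C `*` `[a, b]))); last first.
  by apply: m_A_subset => p [/CE[]].
have mR : measurable (C `*` `[a, b] : set pt) by apply: measurableX => //; exact: measurable_itv.
rewrite /m_A (_ : _ `&` _ = C `*` `[a, b]); last first.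
  by apply/seteqP; split => p; [case|move=> Cp; split => //; have [] := CE p Cp].
apply: mule_gt0; first by rewrite lte_fin invr_gt0 exprn_gt0// pi_gt0.
(* A lower bound for the density on the rectangle, since [|a| + |b|] bounds every second coordinate
   in absolute value. *)
pose k := (1 + (`|a| + `|b|) ^+ 2)^-1.
have k0 : 0 < k by rewrite invr_gt0.
apply: (@lt_le_trans _ _ (\int[lam \x lam]_(p in C `*` `[a, b]) (cst k%:E p))%E).
  rewrite integral_cst//; apply: mule_gt0; first by rewrite lte_fin.
  apply: (@lt_le_trans _ _ (lam C * lam `[a, b])%E); last first.
    rewrite le_eqVlt; apply/orP; left; apply/eqP/esym.
    by apply: product_measure1E => //; exact: measurable_itv.
  by apply: mule_gt0 => //; rewrite lebesgue_measure_itv /= lte_fin ab lte_fin subr_gt0.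
apply: ge0_le_integral => //.
- by move=> p _; rewrite lee_fin ltW.
- exact: measurable_h.
- move=> p [_ /=]; rewrite in_itv /= => /andP[p1 p2].
  rewrite lee_fin lef_pV2 ?posrE// lerD2l -[leLHS]real_normK ?num_real//.
  apply: lerXn2r; rewrite ?nnegrE ?addr_ge0//.
  have := ler_norm b; have := ler_norm (- a); rewrite normrN ler_norml.
  have := normr_ge0 a; have := normr_ge0 b; move=> ? ? ? ?; apply/andP; split; lra.
Qed.

(** By Tonelli the mass before normalisation is [2 * pi] times the integral [pi / 2] of
    [1 / (1 + s ^ 2)] over the half-line, that is [pi ^ 2]. *)
Lemma m_A_total : m_A [set: pt] = 1%E.
Proof.
rewrite /m_A setTI integral_mkcond.
have mh : measurable_fun setT (h \_ (@Adom R)).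
  by apply/(measurable_restrictT _ _).1 => //; exact: measurable_h.
have h0 p : (0 <= (h \_ (@Adom R)) p)%E by rewrite /patch; case: ifP.
have -> : (\int[lam \x lam]_p (h \_ (@Adom R)) p)%E = (\int[lam]_x fubini_F lam (h \_ (@Adom R)) x)%E.
  exact: fubini_tonelli1.
have F x : fubini_F lam (h \_ (@Adom R)) x = ((cst (pi / 2)%:E) \_ `[0%R, 2 * pi[%classic) x.
  rewrite /fubini_F /patch; case: ifPn => [|/negP].
    rewrite inE /= in_itv /= => x2.
    rewrite -(@integral0y_oneDsqr R) [RHS]integral_mkcond; apply: eq_integral => s _.
    rewrite /patch /Adom /h /oneDsqr.
    have -> : ((x, s) \in [set p : pt | 0 <= p.1 < 2 * pi /\ 0 <= p.2]) = (s \in `[0, +oo[%classic).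
      by apply/idP/idP; rewrite !inE /= in_itv /= andbT; [case|split].
    by case: ifP.
  rewrite inE /= in_itv /= => x2; rewrite [RHS]/=.
  rewrite (eq_integral (cst 0%E)) ?integral0//.
  by move=> s _; rewrite ifF//; apply/negP; rewrite inE => -[/= /x2].
under eq_integral do rewrite F.
rewrite -integral_mkcond integral_cst//.
transitivity (((pi ^+ 2)^-1)%:E * ((pi / 2)%:E * (2 * pi)%:E) : \bar R)%E.
  congr (_ * (_ * _))%E; have := @lebesgue_measure_itv R `[0%R, 2 * pi[.
  by rewrite /= lte_fin mulr_gt0 ?pi_gt0// -EFinB subr0.
rewrite -!EFinM; congr EFin.
have : pi != 0 :> R by rewrite gt_eqF// pi_gt0.
by move: (pi : R) => p p0; rewrite -exprVn; field.
Qed.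

Lemma m_A_sigma_additive (F : nat -> set pt) : (forall k, measurable (F k `&` @Adom R)) ->
  trivIset setT (fun k => F k `&` @Adom R) ->
  (fun n => \sum_(0 <= i < n) m_A (F i))%E @ \oo --> m_A (\bigcup_k F k).
Proof.
move=> mF tF; rewrite /m_A setI_bigcupl.
have -> : (\int[lam \x lam]_(p in \bigcup_k (F k `&` @Adom R)) ((1 + p.2 ^+ 2)^-1)%:E =
    \sum_(k <oo) \int[lam \x lam]_(p in F k `&` @Adom R) ((1 + p.2 ^+ 2)^-1)%:E)%E.
  apply: (@ge0_integral_bigcup _ _ _ (lam \x lam)%E (fun k => F k `&` @Adom R) h mF _ _ tF); first exact: measurable_h.
  by move=> p _; exact: h_ge0.
have -> : (fun n => \sum_(0 <= i < n) ((pi ^+ 2)^-1)%:E *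
      \int[lam \x lam]_(p in F i `&` @Adom R) ((1 + p.2 ^+ 2)^-1)%:E)%E =
    (fun n => ((pi ^+ 2)^-1)%:E * \sum_(0 <= i < n)
      \int[lam \x lam]_(p in F i `&` @Adom R) ((1 + p.2 ^+ 2)^-1)%:E)%E.
  by apply/funext => n; rewrite ge0_sume_distrr// => i _; apply: integral_ge0 => p _; exact: h_ge0.
apply: cvgeZl => //; apply: is_cvg_nneseries => i _ _; by apply: integral_ge0 => p _; exact: h_ge0.
Qed.

End PlaneMeasure.

(** The image of an interval of length [l] lies in the interval of length [2 * l] centred at the
    image of the midpoint. A cover of [N] of total length [e / 2] thus yields a cover of the image
    of total length at most [e]. *)
Lemma lipschitz_null (R : realType) (f : R -> R) (N : set R) :
  (forall x y, `|f x - f y| <= `|x - y|) ->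
  (@lebesgue_measure R).-negligible N -> (@lebesgue_measure R).-negligible (f @` N).
Proof.
move=> fL /negligible_outer_measure N0; apply/negligible_outer_measure.
set l := wlength idfun in N0 *.
apply/eqP; rewrite eq_le outer_measure_ge0 andbT; apply/lee_addgt0Pr => /= e e0; rewrite add0e.
have e20 : 0 < e / 2 by rewrite divr_gt0.
have [F [Fi NF] Fe] : exists2 F, open_itv_cover N F & (\sum_(0 <= k <oo) l (F k) <= (e / 2)%:E)%E.
  have := N0; rewrite outer_measure_open_itv_cover => N0'.
  have : ereal_inf [set (\sum_(0 <= k <oo) l (F k))%E | F in open_itv_cover N] \is a fin_num.
    by rewrite N0'.
  move=> /lb_ereal_inf_adherent-/(_ _ e20)[_/= [F]] AF <- Fe.
  by exists F => //; rewrite N0' add0e in Fe; exact/ltW.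
have l0 k : (0 <= l (F k))%E by exact: wlength_ge0.
have sub : f @` N `<=` \bigcup_k f @` F k.
  by move=> _ [x /NF[k _ Fkx] <-]; exists k => //; exists x.
apply: (@le_trans _ _ (l^* (\bigcup_k f @` F k))%mu); first exact: le_outer_measure.
apply: (@le_trans _ _ (\sum_(0 <= k <oo) (l^* (f @` F k))%mu)%E).
  exact: outer_measure_sigma_subadditive.
apply: (@le_trans _ _ (\sum_(0 <= k <oo) 2%:E * l (F k))%E); last first.
  rewrite nneseriesZl//; apply: le_trans (lee_wpmul2l _ Fe) _ => //.
  by rewrite -EFinM lee_fin mulrCA divff// mulr1.
apply: lee_nneseries => [k _|k _ /=]; first by move=> _; exact: outer_measure_ge0.
have [[a b] Fab] := Fi k; have [ab|ba] := ltP a b; last first.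
  rewrite Fab set_itv_ge ?bnd_simp -?leNgt// image_set0 outer_measure0.
  by apply: mule_ge0 => //; exact: wlength_ge0.
pose c := f ((a + b) / 2).
have sub2 : f @` F k `<=` `[c - (b - a), c + (b - a)]%classic.
  move=> _ [x + <-]; rewrite Fab /= !in_itv /= => /andP[ax xb].
  have := fL x ((a + b) / 2); rewrite -/c => /le_trans/(_ (_ : _ <= b - a)).
  have H : `|x - (a + b) / 2| <= b - a by rewrite ler_norml; apply/andP; split; lra.
  by move=> /(_ H); rewrite ler_norml => /andP[? ?]; apply/andP; split; lra.
apply: (@le_trans _ _ (l^* `[c - (b - a), c + (b - a)]%classic)%mu); first exact: le_outer_measure.
apply: (@le_trans _ _ (lebesgue_measure `[c - (b - a), c + (b - a)]%classic)); first by [].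
rewrite lebesgue_measure_itv /=.
rewrite ifT; last by rewrite lte_fin; lra.
rewrite Fab /l wlength_itv /= lte_fin ab.
by rewrite -!EFinB -EFinM lee_fin; lra.
Qed.

Lemma lebesgue_negligible_eq0 (R : realType) (A : set R) : measurable A ->
  (@lebesgue_measure R).-negligible A -> @lebesgue_measure R A = 0%E.
Proof.
move=> mA [B [mB B0 AB]]; apply/eqP; rewrite -measure_le0 -B0.
by apply: le_measure; rewrite ?inE.
Qed.

Lemma cos_lipschitz (R : realType) (x y : R) : `|cos x - cos y| <= `|x - y|.
Proof.
wlog xy : x y / x <= y => [W|].
  by have [/W//|/ltW/W] := leP x y; rewrite distrC [in leRHS]distrC.
have [|c _ e] := @MVT_segment R cos (fun z => - sin z) x y xy.
  by apply: continuous_subspaceT => z; exact: continuous_cos.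
rewrite distrC e normrM normrN [in leRHS]distrC ler_piMl// ler_norml sin_geN1 sin_le1//.
Qed.

Lemma cos_preimage_gt0 (R : realType) (N : set R) : measurable N ->
  @lebesgue_measure R N = 0%E ->
  let C := `[0, pi]%classic `&` cos @^-1` (~` N) in
  measurable C /\ (0 < @lebesgue_measure R C)%E.
Proof.
move=> mN N0 C.
have mC : measurable C.
  apply: measurableI; first exact: measurable_itv.
  rewrite -[X in measurable X]setTI; apply: (continuous_measurable_fun (@continuous_cos R)) => //.
  exact: measurableC.
split => //; rewrite lt_neqAle measure_ge0 andbT; apply/negP => /eqP C0.
have nU : (@lebesgue_measure R).-negligible (N `|` cos @` C).
  have nN : (@lebesgue_measure R).-negligible N by exists N; split.
  have nC : (@lebesgue_measure R).-negligible C by exists C; split.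
  exact: (negligibleU nN (lipschitz_null (@cos_lipschitz R) nC)).
have nI : (@lebesgue_measure R).-negligible (`[-1, 1]%classic : set R).
  apply: negligibleS nU.
    move=> x /=; rewrite in_itv /= => x1; have [Nx|Nx] := pselect (N x); [by left|right].
    exists (acos x); last by rewrite acosK// in_itv.
    split; first by rewrite /= in_itv /= acos_ge0// acos_lepi.
    by rewrite /= acosK// in_itv.
have := lebesgue_negligible_eq0 (measurable_itv _) nI.
rewrite lebesgue_measure_itv /= lte_fin ifT; last by lra.
by rewrite -EFinB => -[]; lra.
Qed.

Section Laws.
Context {R : realType}.

Lemma Rintegral_eq_law {d1 d2 d : measure_display} {X1 : measurableType d1}
  {X2 : measurableType d2} {Y : measurableType d}
  (P1 : probability X1 R) (P2 : probability X2 R)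
  (f1 : X1 -> Y) (f2 : X2 -> Y) (g : Y -> R) (C : R) :
  measurable_fun setT f1 -> measurable_fun setT f2 -> measurable_fun setT g ->
  (forall y, `|g y| <= C) ->
  (forall B, measurable B -> P1 (f1 @^-1` B) = P2 (f2 @^-1` B)) ->
  \int[P1]_x g (f1 x) = \int[P2]_x g (f2 x).
Proof.
move=> m1 m2 mg gC e; rewrite /Rintegral; congr fine.
have mg' : measurable_fun setT (EFin \o g) by exact/measurable_EFinP.
have i1 : P1.-integrable (f1 @^-1` setT) ((EFin \o g) \o f1).
  apply: (@bounded_integrable _ _ _ P1 setT (g \o f1) C) => // [|x _]; [exact: (measurableT_comp mg m1)|exact: gC].
have i2 : P2.-integrable (f2 @^-1` setT) ((EFin \o g) \o f2).
  apply: (@bounded_integrable _ _ _ P2 setT (g \o f2) C) => // [|x _]; [exact: (measurableT_comp mg m2)|exact: gC].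
transitivity (\int[pushforward P1 f1]_y (EFin \o g) y)%E.
  by rewrite (integral_pushforward m1 mg' i1).
transitivity (\int[pushforward P2 f2]_y (EFin \o g) y)%E; last first.
  by rewrite (integral_pushforward m2 mg' i2).
by apply: eq_measure_integral => B mB _; exact: e.
Qed.

Lemma Rintegral_full {d : measure_display} {X : measurableType d} (P : probability X R)
  (D : set X) (f : X -> R) : measurable D -> P D = 1%E -> P.-integrable setT (EFin \o f) ->
  \int[P]_(x in D) f x = \int[P]_x f x.
Proof.
move=> mD PD fi; rewrite /Rintegral; congr fine.
have mDc := measurableC mD.
rewrite [RHS](negligible_integral mDc measurableT fi) ?setDE ?setCK ?setTI//.
by have := probability_setC P mD; rewrite PD subee.
Qed.

End Laws.

(** * The measure [rho'] on the inverse limit *)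

Section Main.
Context {R : realType}.
Local Notation pt := (R * R)%type.
Local Notation seqT := {ptws nat -> (R * R)%type}.
Local Notation testT := (nat * (nat * seq ((rat * rat) * (rat * nat))))%type.
Variables (phi : R -> R -> pt) (Ups : pt -> pt) (fb : R -> pt -> pt) (t : R).
Hypotheses (hphi : cyl_param phi) (hUps : is_Upsilon phi Ups)
  (hfb : unwrapping phi Ups fb) (ht : Jint t).
Local Notation H := (Ups \o fb t).
Local Notation lam := (@lebesgue_measure R).

Let Aslab_truncn (p : pt) : Adom p -> Aslab (Num.truncn p.2) p.
Proof. by move=> [p1 p2]; split => //; have /andP[] := truncn_itv p2. Qed.

Lemma measurable_Psi_preimage (E : set seqT) : Borel E ->
  measurable ((Psi phi H : pt -> seqT) @^-1` E `&` @Adom R).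
Proof.
move=> bE.
have mS k : measurable (@Aslab R k).
  have -> : @Aslab R k = (`[0, 2 * pi[ `*` `[k%:R, k.+1%:R[)%classic.
    apply/seteqP; split => p /=; rewrite !in_itv /=; first by case=> -> -> ->.
    by move=> [? /andP[]].
  by apply: measurableX; exact: measurable_itv.
have -> : (Psi phi H : pt -> seqT) @^-1` E `&` @Adom R =
    \bigcup_k (@Aslab R k `&` (Psi phi H : pt -> seqT) @^-1` E).
  apply/seteqP; split => p; first by move=> [Ep Ap]; exists (Num.truncn p.2) => //; split => //; exact: Aslab_truncn.
  by move=> [k _ [[p1 p2 _] Ep]]; split => //; split => //; apply: le_trans p2.
apply: bigcupT_measurable => k.
have mf : measurable_fun (@Aslab R k) (Psi phi H : pt -> Bor R).
  apply: (@measurability _ _ _ (Bor R) _ _ (@open seqT)) => // _ [U oU <-].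
  have /open_subspaceP[V oV VU] : open ((Psi phi H : pt -> seqT) @^-1` U : set (subspace (@Aslab R k))).
    by move/continuousP: (continuous_Psi_slab (k := k) hphi hUps hfb ht); apply.
  by rewrite setIC -VU; apply: measurableI => //; exact: measurable_open_plane.
exact: mf.
Qed.

Let preimage_Adom (E : set seqT) :
  (Psi phi H : pt -> seqT) @^-1` (E `\` Ihat phi H) `&` @Adom R =
  (Psi phi H : pt -> seqT) @^-1` E `&` @Adom R.
Proof.
apply/seteqP; split => -[y s]; first by move=> [[Ep _] Ap].
by move=> [Ep Ap]; split => //; split => //; apply: (Psi_notin_Ihat hphi); case: Ap.
Qed.

Lemma rho'_Borel_probability : borel_probability_on (Dhat H) (rho' phi H).
Proof.
split.
- by rewrite /rho' set0D preimage_set0; apply: (@m_A_singleton _ _ (0, 0)) => p [].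
- by move=> E _ _; exact: m_A_ge0.
- move=> F HF tF; rewrite /rho'.
  have -> : (Psi phi H : pt -> seqT) @^-1` ((\bigcup_n F n) `\` Ihat phi H) =
      \bigcup_n (Psi phi H : pt -> seqT) @^-1` (F n `\` Ihat phi H).
    by rewrite setDE setI_bigcupl preimage_bigcup.
  apply: m_A_sigma_additive => [k|i j _ _ [p [[[Fi _] _] [[Fj _] _]]]].
    by rewrite preimage_Adom; apply: measurable_Psi_preimage; have [] := HF k.
  by apply: tF => //; exists (Psi phi H p).
- rewrite -(@m_A_total R); apply: m_A_eq; rewrite preimage_Adom setTI.
  by apply/seteqP; split => [p []//|[y s] Ap]; split => //; apply: Psi_Dhat; case: Ap.
Qed.

Lemma rho'_oxtoby_ulam : oxtoby_ulam (Dhat H) (rho' phi H).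
Proof.
split; first exact: rho'_Borel_probability.
- move=> z _; rewrite /rho'.
  have [[p [Ap Ep]]|no] := pselect (exists p, Adom p /\ Psi phi H p = z).
    apply: (@m_A_singleton _ _ p); rewrite preimage_Adom => q [/= Eq Aq].
    exact: (Psi_inj hphi Aq Ap (etrans Eq (esym Ep))).
  apply: (@m_A_singleton _ _ (0, 0)); rewrite preimage_Adom => q [/= Eq Aq].
  by exfalso; apply: no; exists q.
- move=> O oO [z [Oz Dz]].
  have [p Ap Op] := Psi_dense hphi hUps hfb ht oO Oz Dz.
  set k := Num.truncn p.2; have [p1 kp pk] := Aslab_truncn Ap; rewrite -/k in kp pk.
  have : nbhs p (fun q => Aslab k q -> O (Psi phi H q)).
    have /subspace_continuousP/(_ p (Aslab_truncn Ap)) := continuous_Psi_slab (k := k) hphi hUps hfb ht.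
    by apply; exact: open_nbhs_nbhs.
  move=> /nbhs_ballP[e e0 He]; have e0' : 0 < e := e0.
  have /andP[p10 p12] := p1; have [_ p20] := Ap.
  (* At most half the room to the right of and above [p], so that the square of side [d] with lower
     left corner [p] stays in the slab and in the ball of radius [e]. *)
  pose d := Num.min e (Num.min (2 * pi - p.1) (k.+1%:R - p.2)) / 2.
  have d0 : 0 < d by rewrite divr_gt0// !lt_min e0' !subr_gt0 p12 pk.
  have [de dp dk] : [/\ d < e, d < 2 * pi - p.1 & d < k.+1%:R - p.2].
    have : d < Num.min e (Num.min (2 * pi - p.1) (k.+1%:R - p.2)) by move: d0; rewrite /d; lra.
    by rewrite !lt_min => /and3P[].
  apply: (@m_A_rect_gt0 _ `[p.1, p.1 + d] p.2 (p.2 + d)); first exact: measurable_itv.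
  + by rewrite lebesgue_measure_itv /= lte_fin ltrDl d0 lte_fin; lra.
  + by rewrite ltrDl.
  rewrite preimage_Adom => q [/=]; rewrite !in_itv /= => /andP[a1 a2] /andP[b1 b2].
  have Aq : Adom q by split; [apply/andP; split; lra|lra].
  split => //; split; last by case: q Aq {a1 a2 b1 b2} => y s Aq; apply: Psi_Dhat; case: Aq.
  apply: He; first by split; rewrite /ball /= ltr_norml; apply/andP; split; lra.
  by split; [case: Aq|apply: le_trans b1|lra].
(* Parameters with [s > 0] give interior points, so the boundary only meets the image of the line
   [s = 0], which is null. *)
- apply: m_A_bottom; rewrite preimage_Adom => -[y s] [[_ bd] [_ s0]] /=.
  have [s0'|] := ltP 0 s; first by exfalso; apply: bd; exact: Psi_interior.
  by move=> ?; apply/eqP; rewrite eq_le s0 andbT.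
Qed.

Variables (mu : probability R R) (muhat : probability (Bor R) R).
Hypotheses (hmu : acip t mu) (hmuhat : natext_measure phi H mu muhat).

Let muhatD : muhat (Dhat H : set (Bor R)) = 1%E.
Proof. by case: hmuhat. Qed.

Let mIint : measurable (@Iint R). Proof. exact: measurable_itv. Qed.

(** Extension by the origin outside [[-1, 1]]: each coordinate becomes a function continuous on the
    interval and zero elsewhere, hence measurable on the whole line. *)
Let iotaI (x : R) : pt := if `[< Iint x >] then Defs.iota phi x else (0, 0).

Let iotaI_E x : Iint x -> iotaI x = Defs.iota phi x.
Proof. by move=> Ix; rewrite /iotaI asboolT. Qed.

Let measurable_iotaI : measurable_fun setT iotaI.
Proof.
have mI (c : pt -> R) : continuous c -> c (0, 0) = 0 ->
    measurable_fun setT (fun x => c (iotaI x)).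
  move=> cc c0.
  have -> : (fun x => c (iotaI x)) = (c \o Defs.iota phi) \_ (@Iint R).
    apply/funext => x; rewrite /patch /iotaI.
    by case: asboolP => [Ix|nIx]; [rewrite mem_set|rewrite memNset].
  have cI : {within @Iint R, continuous (c \o Defs.iota phi)}.
    apply: (continuous_within_comp (B := setT) (within_continuous_iota hphi)) => //.
    exact: continuous_subspaceT.
  exact: (measurable_restrictT (c \o Defs.iota phi) mIint).1 (subspace_continuous_measurable_fun mIint cI).
have -> : iotaI = (fun x => ((iotaI x).1, (iotaI x).2)) by apply/funext => x; case: (iotaI x).
by apply: measurable_fun_pair; apply: mI => // z; [exact: cvg_fst|exact: cvg_snd].
Qed.

Let measurable_coord n : measurable_fun setT (fun z : Bor R => z n : pt).
Proof.
have mc (c : pt -> R) : continuous c -> measurable_fun setT (fun z : Bor R => c (z n : pt)).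
  move=> cc _; apply: (measurability _ (RGenCInfty.measurableE R)) => //.
  move=> _ [_ [x ->] <-]; rewrite setTI; apply: Borel_closed.
  apply: (preimage_closed (f := fun z : seqT => c (z n))); last exact: interval_closed.
  by move=> z _; exact: (continuous_comp (@continuous_coord R n z) (cc _)).
have -> : (fun z : Bor R => z n : pt) = (fun z : Bor R => ((z n : pt).1, (z n : pt).2)).
  by apply/funext => z; case: (z n).
by apply: measurable_fun_pair; apply: mc => z; [exact: cvg_fst|exact: cvg_snd].
Qed.

(** A test reads one coordinate, whose law under [muhat] is the image of [mu] under the embedding of
    the interval. *)
Lemma Rintegral_test (i : testT) :
  \int[muhat]_(z in (Dhat H : set (Bor R))) test i z =
  \int[mu]_x max_cone i.2.1 i.2.2 (iotaI x).
Proof.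
have [C HC] := @max_cone_bounded R i.2.1 i.2.2.
have mg := @measurable_max_cone R i.2.1 i.2.2.
rewrite Rintegral_full//.
- apply: (Rintegral_eq_law (f1 := fun z : Bor R => z i.1 : pt) (g := max_cone i.2.1 i.2.2) (C := C)) => //.
  move=> B mB; have [_ _ ->//] := hmuhat.
  have mA : measurable (iotaI @^-1` B) by rewrite -[X in measurable X]setTI; exact: measurable_iotaI.
  rewrite (acip_Iint hmu mA); congr (mu _).
  by apply/seteqP; split => x /= [Ix]; rewrite iotaI_E.
- exact: Borel_closed (closed_Dhat hphi hUps hfb ht).
- apply: (@bounded_integrable _ _ _ muhat setT (fun z : Bor R => test i z) C) => // [|z _]; last exact: HC.
  exact: (measurableT_comp mg (@measurable_coord i.1)).
Qed.

Lemma rho'_regular_gt0 :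
  (0 < rho' phi H [set z | Dhat H z /\ regular_point (Dhat H) (Hhat H) muhat z])%E.
Proof.
pose b (i : testT) x := max_cone i.2.1 i.2.2 (iotaI x).
have /choice[N HN] (i : testT) : exists N : set R, [/\ measurable N, lam N = 0%E &
    forall x, Iint x -> ~ N x -> (fun n : nat => n%:R^-1 * \sum_(j < n) b i (iter j (ft t) x)) @ \oo -->
      \int[mu]_x b i x].
  have [C HC] := @max_cone_bounded R i.2.1 i.2.2.
  apply: (tent_birkhoff ht hmu (C := C)) => [|x]; last exact: HC.
  exact: (measurableT_comp (@measurable_max_cone R i.2.1 i.2.2) measurable_iotaI).
pose S (k : nat) := if unpickle k is Some i then N i else set0.
have mS k : measurable (S k) by rewrite /S; case: (unpickle k) => [i|//]; case: (HN i).
have mN : measurable (\bigcup_k S k) by exact: bigcupT_measurable.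
have N0 : lam (\bigcup_k S k) = 0%E.
  apply: (lebesgue_negligible_eq0 mN); apply: negligible_bigcup => k; exists (S k); split; [exact: mS| |by []].
  by rewrite /S; case: (unpickle k) => [i|]; [case: (HN i)|exact: measure0].
have [mC C0] := cos_preimage_gt0 mN N0.
(* For [1 <= s <= 3 / 2] the height [s / 2] lies between 1/2 and 3/4: there [fb t] is the identity
   and [Ups] raises the point to level 1, which yields the zeroth coordinate. *)
apply: (m_A_rect_gt0 (a := 1) (b := 3 / 2) mC C0); first by lra.
rewrite preimage_Adom => -[y s] [[/= + Ny]]; rewrite !in_itv /= => /andP[y0 ypi] /andP[s1 s2].
have As : Adom (y, s).
  by split => /=; [apply/andP; split => //; have := pi_gt0 R; lra|lra].
split => //=; have Dz : Dhat H (Psi phi H (y, s)) by apply: Psi_Dhat => //; case: As.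
split => //; apply/(regular_pointP hphi hUps hfb ht muhatD Dz) => i.
have Icos : Iint (cos y) by rewrite /Iint /= in_itv /= cos_geN1 cos_le1.
have z0 : Psi phi H (y, s) 0%N = Defs.iota phi (cos y).
  have tr : Num.truncn s = 1%N by apply/truncn_def; apply/andP; split; lra.
  have -> : Psi phi H (y, s) 0%N = H (phi y (s / 2)).
    by rewrite /Psi [(y, s).2]/= ltNge s1 [(y, s).1]/= tr subrK.
  rewrite (H_low hUps hfb ht); last by apply/andP; split; lra.
  by rewrite iota_cos//; congr phi; apply/min_idPr; lra.
rewrite Rintegral_test.
apply: (@cesaro_shift _ (fun n => test i (iter n (Hhat H) (Psi phi H (y, s))))
  (fun n => b i (iter n (ft t) (cos y))) i.1).
  move=> n; rewrite /test iter_Hhat_coord ?leq_addl// addnK z0 (iter_H_iota hfb ht)//.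
  by rewrite /b iotaI_E//; exact: iter_ft_Iint.
have [_ _] := HN i; apply => // Ni; apply: Ny; exists (pickle i) => //.
by rewrite /S pickleK.
Qed.

End Main.

Theorem mainTheorem8 (R : realType)
  (phi : R -> R -> (R * R)%type) (Ups : (R * R)%type -> (R * R)%type)
  (fb : R -> (R * R)%type -> (R * R)%type)
  (hphi : cyl_param phi) (hUps : is_Upsilon phi Ups)
  (hfb : unwrapping phi Ups fb)
  (t : R) (ht : Jint t)
  (mu : probability R R) (hmu : acip t mu)
  (muhat : probability (Bor R) R)
  (hmuhat : natext_measure phi (Ups \o fb t) mu muhat) :
  oxtoby_ulam (Dhat (Ups \o fb t)) (rho' phi (Ups \o fb t)) /\
  Borel [set x | Dhat (Ups \o fb t) x /\
                 regular_point (Dhat (Ups \o fb t)) (Hhat (Ups \o fb t)) muhat x] /\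
  (0 < rho' phi (Ups \o fb t)
         [set x | Dhat (Ups \o fb t) x /\
                  regular_point (Dhat (Ups \o fb t)) (Hhat (Ups \o fb t)) muhat x])%E.
Proof.
split; first exact: rho'_oxtoby_ulam.
split; last exact: (rho'_regular_gt0 hphi hUps hfb ht hmu hmuhat).
have [D1 _ _] := hmuhat; exact: (Borel_regular hphi hUps hfb ht D1).
Qed.
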